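(* For all integers $n\geq m\geq 3$, $$R(\mathcal{P}^3_n,\mathcal{P}^3_m)=R(\mathcal{P}^3_n,\mathcal{C}^3_m)=R(\mathcal{C}^3_n,\mathcal{C}^3_m)+1=2n+\left\lfloor\frac{m+1}{2}\right\rfloor .$$
   Context: For $k$-uniform hypergraphs $\mathcal{G},\mathcal{H}$, the Ramsey number $R(\mathcal{G},\mathcal{H})$ is the smallest integer $N$ such that every red-blue coloring of the edges of the complete $k$-uniform hypergraph $\mathcal{K}^k_N$ on $N$ vertices contains a red copy of $\mathcal{G}$ or a blue copy of $\mathcal{H}$ (copies are sub-hypergraphs, not necessarily induced). The $k$-uniform loose cycle $\mathcal{C}^k_n$ (cycle of length $n$) has vertex set $\{v_1,\ldots,v_{n(k-1)}\}$ and the $n$ edges $e_i=\{v_{(i-1)(k-1)+1},v_{(i-1)(k-1)+2},\ldots,v_{i(k-1)+1}\}$, $i=1,\ldots,n$, with subscripts taken mod $n(k-1)$. The $k$-uniform loose path $\mathcal{P}^k_n$ (path of length $n$) has vertex set $\{v_1,\ldots,v_{n(k-1)+1}\}$ and the $n$ edges $e_i=\{v_{(i-1)(k-1)+1},\ldots,v_{i(k-1)+1}\}$, $i=1,\ldots,n$ (no reduction of subscripts). Here $k=3$. *)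

(* Defs.v *)
From mathcomp Require Import all_boot.

Set Implicit Arguments.
Unset Strict Implicit.
Unset Printing Implicit Defensive.

(* A hypergraph on the finite vertex type V is given by its set of edges. *)
Definition hypergraph (V : finType) := {set {set V}}.

Definition complete_hypergraph (k N : nat) : hypergraph 'I_N :=
  [set e : {set 'I_N} | #|e| == k].

(* H contains a copy of G as a (not necessarily induced) sub-hypergraph. *)
Definition contains_copy (V W : finType)
    (H : hypergraph W) (G : hypergraph V) : Prop :=
  exists f : V -> W,
    injective f /\ forall e : {set V}, e \in G -> f @: e \in H.

(* The vertex v_(j+1) of the usual 1-based description is the ordinal j, and
   the edge e_(i+1) is loose_path_edge k n i (resp. loose_cycle_edge k n i). *)
Definition loose_path_edge (k n : nat) (i : 'I_n) : {set 'I_(n * k.-1).+1} :=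
  [set v : 'I_(n * k.-1).+1 | i * k.-1 <= v <= i.+1 * k.-1].

Definition loose_path (k n : nat) : hypergraph 'I_(n * k.-1).+1 :=
  [set loose_path_edge k i | i : 'I_n].

Definition loose_cycle_edge (k n : nat) (i : 'I_n) : {set 'I_(n * k.-1)} :=
  [set v : 'I_(n * k.-1) |
    [exists j : 'I_k, v == (i * k.-1 + j) %% (n * k.-1) :> nat]].

Definition loose_cycle (k n : nat) : hypergraph 'I_(n * k.-1) :=
  [set loose_cycle_edge k i | i : 'I_n].

(* Edges coloured true are red, those coloured false are blue; the values of
   c outside the edges of the complete hypergraph are irrelevant. *)
Definition ramsey_arrow (k : nat) (V W : finType)
    (G : hypergraph V) (H : hypergraph W) (N : nat) : Prop :=
  forall c : {set 'I_N} -> bool,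
    contains_copy [set e in complete_hypergraph k N | c e] G \/
    contains_copy [set e in complete_hypergraph k N | ~~ c e] H.

(* R(G, H) = N, for k-uniform G and H. *)
Definition is_ramsey_number (k : nat) (V W : finType)
    (G : hypergraph V) (H : hypergraph W) (N : nat) : Prop :=
  ramsey_arrow k G H N /\
  forall M : nat, ramsey_arrow k G H M -> N <= M.

(* Main.v *)
(* The upper bounds rest on R(C_n, C_m) <= 2n + floor((m-1)/2), proved by induction from a red
   C_{n-1} in a colouring without red C_n. Let W be the set of vertices outside the red cycle. No
   block of consecutive edges of the cycle can be replaced by a red path with one more edge on the
   vertices of the block and of W. For a pair of consecutive edges this yields, for almost all u, v
   in W, a blue path u, s1, s2, s3, v whose three inner vertices lie on the pair and avoid its last
   joint (a left path), its first joint (a right path) or both (an inner path). Blue paths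
   on disjoint pairs are chained through W and the chain is closed on the few remaining edges of the
   cycle; a pair that only admits a right path is merged with the pair that follows it. Each
   local claim concerns boundedly many vertices and is settled by a small decision tree.
   If there is a red C_n but no red P_n, every pair admits an inner path for all u, v, which gives
   the results for paths. For the lower bounds, the red edges are those inside a fixed set of 2n
   vertices (2n - 1 for two cycles): every other vertex lies on at most two edges of P_m or C_m. *)
Require Import Defs.
From mathcomp Require Import all_boot zify.
From Stdlib Require Import Classical.

Set Implicit Arguments.
Unset Strict Implicit.
Unset Printing Implicit Defensive.

(** * Loose walks *)

(** The constants come from an exact count. A pair of a chain gives two blue edges and costs one new
    vertex of W, and a red cycle with n - 1 edges leaves at least 2 + floor((m-1)/2) vertices in W.
    For m > 3 write m = 2t + d + 3 with d in {1, 2} fixed by parity: W then has at least t + d + 2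
    vertices, just what t pairs and a closing need. For m = n the red cycle has only m - 1 edges, so
    all of them may be spent and the closing must gain one edge. Hence the care about joints:
    consecutive pairs share one, and a right path followed by a left path would use it twice. The
    closing takes two forms. If some pair with blue ends lacks a left path for some u, v, this very
    failure provides a closing path on the pair and the next d edges. Otherwise all pairs have left
    paths, and a chain that starts with an inner pair leaves free both end joints of a gap of d
    edges. For m = n the induction goes through the case (n-1, n-1), and a blue cycle found there is
    lengthened with the colours exchanged. *)

Definition sym3 (T : Type) (c : T -> T -> T -> bool) :=
  (forall x y z, c x y z = c y x z) /\ (forall x y z, c x y z = c x z y).

Definition neg3 (T : Type) (c : T -> T -> T -> bool) x y z := ~~ c x y z.

Lemma sym3_neg (T : Type) (c : T -> T -> T -> bool) : sym3 c -> sym3 (neg3 c).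
Proof. by case=> h1 h2; split=> x y z; rewrite /neg3; [rewrite h1 | rewrite h2]. Qed.

(* The edges are the triples at positions (0, 1, 2), (2, 3, 4), ... of x :: s. *)
Fixpoint walk (T : Type) (c : T -> T -> T -> bool) (x : T) (s : seq T) :=
  if s is y :: z :: s' then c x y z && walk c z s' else nilp s.

Lemma pair_ind (T : Type) (P : seq T -> Prop) :
  P [::] -> (forall x, P [:: x]) -> (forall x y s, P s -> P (x :: y :: s)) ->
  forall s, P s.
Proof.
move=> h0 h1 h2 s; have [n] := ubnP (size s); elim: n s => // n IH [|x [|y s]] //= ltn.
by apply/h2/IH; lia.
Qed.

Lemma walk_nth (T : Type) (c : T -> T -> T -> bool) x0 x s i :
  walk c x s -> i.*2.+1 < size s ->
  c (nth x0 (x :: s) i.*2) (nth x0 (x :: s) i.*2.+1) (nth x0 (x :: s) i.*2.+2).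
Proof.
elim/pair_ind: s x i => [|y|y z s IH] x [|i] //=; first by case/andP.
by case/andP=> _ wk; rewrite doubleS !ltnS; exact: (IH z i).
Qed.

Section Walks.
Variable T : eqType.
Implicit Types (c : T -> T -> T -> bool) (x y z u v w : T) (p q s S W V : seq T).

Lemma walk_cat c x s1 s2 : ~~ odd (size s1) ->
  walk c x (s1 ++ s2) = walk c x s1 && walk c (last x s1) s2.
Proof.
elim/pair_ind: s1 x => [|y|y z s1 IH] x //=.
by rewrite negbK => ev; rewrite IH // andbA.
Qed.

Lemma walk_map (U : Type) (f : U -> T) c (x : U) (s : seq U) :
  walk c (f x) (map f s) = walk (fun i j k => c (f i) (f j) (f k)) x s.
Proof. by elim/pair_ind: s x => [|y|y z s IH] x //=; rewrite IH. Qed.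

Lemma eq_walk (U : Type) (c d : U -> U -> U -> bool) (x : U) (s : seq U) :
  (forall i j k, c i j k = d i j k) -> walk c x s = walk d x s.
Proof. by move=> e; elim/pair_ind: s x => [|y|y z s IH] x //=; rewrite e IH. Qed.

Lemma sub_walk (U : Type) (c d : U -> U -> U -> bool) (x : U) (s : seq U) :
  (forall i j k, c i j k -> d i j k) -> walk c x s -> walk d x s.
Proof. by move=> e; elim/pair_ind: s x => [|y|y z s IH] x //= /andP[/e -> /IH]. Qed.

Lemma walk_even (U : Type) (c : U -> U -> U -> bool) (x : U) (s : seq U) :
  walk c x s -> ~~ odd (size s).
Proof. by elim/pair_ind: s x => [|y|y z s IH] x //= /andP[_ /IH]; rewrite negbK. Qed.

(* For u = w and k > 2 this is a loose cycle. *)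
Definition lpath c k u w S := exists q,
  [/\ walk c u q, last u q = w, size q = k.*2, uniq q & {subset q <= w :: S}].

Lemma lpath0 c u S : lpath c 0 u u S.
Proof. by exists [::]. Qed.

Lemma lpath_sub_end c k u w S S' :
  {subset S <= w :: S'} -> lpath c k u w S -> lpath c k u w S'.
Proof.
move=> sub [q [h1 h2 h3 h4 h5]]; exists q; split=> // v /h5.
by rewrite inE => /orP[/eqP->|/sub //]; rewrite mem_head.
Qed.

Lemma lpath_sub c k u w S S' :
  {subset S <= S'} -> lpath c k u w S -> lpath c k u w S'.
Proof. by move=> sub; apply: lpath_sub_end => v /sub; rewrite inE orbC => ->. Qed.

(** Disjointness is asked only beyond the two starting points, so [u = w] is allowed: the same lemma
    joins paths and closes cycles. *)
Lemma lpath_cat c k1 k2 u v w S1 S2 :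
  lpath c k1 u v S1 -> lpath c k2 v w S2 ->
  (forall y, y \in v :: S1 -> y \in w :: S2 -> False) ->
  lpath c (k1 + k2) u w (v :: S1 ++ S2).
Proof.
move=> [q1 [a1 a2 a3 a4 a5]] [q2 [b1 b2 b3 b4 b5]] dis; exists (q1 ++ q2); split.
- by rewrite walk_cat ?a1 ?a2 // a3 odd_double.
- by rewrite last_cat a2.
- by rewrite size_cat a3 b3 doubleD.
- rewrite cat_uniq a4 b4 andbT; apply/hasPn => y /b5 y2; apply/negP => /a5 y1.
  exact: (dis y).
- move=> y; rewrite mem_cat => /orP[/a5|/b5]; rewrite !(inE, mem_cat).
    by case/orP=> ->; rewrite ?orbT.
  by case/orP=> ->; rewrite ?orbT.
Qed.

Lemma lpath2_sym c u w S : sym3 c -> u != w -> u \notin S -> w \notin S ->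
  lpath c 2 u w S -> lpath c 2 w u S.
Proof.
move=> [h1 h2] uw uS wS.
case=> q [wq lq sz uq sub].
case: q => [|a [|b [|d [|e [|? ?]]]]] //= in wq lq sz uq sub *; subst e.
case/and3P: wq => c1 c2 _.
have rev x y z : c x y z = c z y x by rewrite h1 h2 h1.
exists [:: d; b; a; u]; split=> //=.
- by rewrite -(rev b d w) c2 -(rev u a b) c1.
- have nu y : y \in [:: a; b; d; w] -> y != u.
    move/sub; rewrite inE => /orP[/eqP->|yS]; first by rewrite eq_sym.
    by apply: contraNneq uS => <-.
  move: uq (nu a) (nu b) (nu d); rewrite /= !inE !eqxx !orbT !negb_or !andbT.
  move=> /and3P[/and3P[ab ad aw] /andP[bd bw] dw] -> // -> // -> //.
  by rewrite !andbT (eq_sym d b) bd (eq_sym d a) ad (eq_sym b a) ab.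
- move=> y; rewrite !inE => hy.
  have: y \in [:: a; b; d; w] -> y != w -> y \in S.
    by move/sub; rewrite inE => /orP[/eqP->|//]; rewrite eqxx.
  move: uq; rewrite /= !inE !negb_or !andbT => /and3P[/and3P[ab ad aw] /andP[bd bw] dw].
  by case/or4P: hy => /eqP->; rewrite ?eqxx ?orbT //= => -> //; rewrite ?eqxx ?orbT.
Qed.

Definition cyc c V k := exists x s,
  [/\ walk c x s, last x s = x, size s = k.*2, uniq s & {subset s <= V}].

Lemma cyc_lpath c V k u S : {subset u :: S <= V} -> lpath c k u u S -> cyc c V k.
Proof.
move=> sub [q [h1 h2 h3 h4 h5]]; exists u, q; split=> //.
by move=> y /h5 /sub.
Qed.

(* p2 is a block of p between two joints, and q would replace it with one more edge. *)
Definition rigid c x p W := forall p1 p2 p3 q, p = p1 ++ p2 ++ p3 ->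
  ~~ odd (size p1) -> ~~ odd (size p2) -> 0 < size p2 ->
  walk c (last x p1) q -> last (last x p1) q = last (last x p1) p2 ->
  size q = (size p2).+2 -> uniq q -> {subset q <= p2 ++ W} -> False.

Lemma rigid_sub c x p W W' : {subset W' <= W} -> rigid c x p W -> rigid c x p W'.
Proof.
move=> sub rg p1 p2 p3 q e0 e1 e2 e3 e4 e5 e6 e7 e8; apply: (rg p1 p2 p3 q) => // y /e8.
by rewrite !mem_cat => /orP[|/sub] ->; rewrite ?orbT.
Qed.

Lemma rigid_block c x p1 p p3 W : ~~ odd (size p1) ->
  rigid c x (p1 ++ p ++ p3) W -> rigid c (last x p1) p W.
Proof.
move=> ev rg q1 q2 q3 q ep e1 e2 e3 e4 e5 e6 e7 e8.
apply: (rg (p1 ++ q1) q2 (q3 ++ p3) q); rewrite ?last_cat //.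
  by rewrite ep !catA.
by rewrite size_cat oddD negb_add (negbTE ev) (negbTE e1).
Qed.

(** Splicing [q] in place of [p2] would produce a closed walk with k + 1 edges; [p2] may be the
    whole cycle. *)
Lemma cyc_rigid c x s V k :
  walk c x s -> last x s = x -> size s = k.*2 -> uniq s -> {subset s <= V} ->
  ~ cyc c V k.+1 -> rigid c x s [seq v <- V | v \notin s].
Proof.
move=> h1 h2 h3 h4 h5 no p1 p2 p3 q es e1 e2 e3 e4 e5 e6 e7 e8; apply: no.
exists x, (p1 ++ q ++ p3); move: h1 h2 h3 h4 h5; rewrite es.
rewrite !walk_cat // ?(walk_even e4) // !last_cat e5 e4 => /and3P[-> _ ->] -> h3 h4 h5; split=> //.
- by move: h3; rewrite !size_cat e6; lia.
- move: h4; rewrite !cat_uniq e7 !has_cat !negb_or => /and5P[-> /andP[d1 d2] u2 d3 ->].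
  rewrite d2 /= !andbT; apply/andP; split; apply/hasPn => y.
    move=> /e8; rewrite mem_cat mem_filter es !mem_cat !negb_or => /orP[/(hasPn d1) //|].
    by case/andP=> /andP[].
  move=> y3; apply/negP => /e8; rewrite mem_cat mem_filter es !mem_cat y3 !orbT orbF.
  exact/negP/(hasPn d3).
- move=> y; rewrite !mem_cat => /or3P[y1|/e8|y3].
  + by apply: h5; rewrite mem_cat y1.
  + rewrite mem_cat mem_filter => /orP[y2|/andP[_ ->] //].
    by apply: h5; rewrite !mem_cat y2 orbT.
  + by apply: h5; rewrite !mem_cat y3 !orbT.
Qed.

Lemma walk_rot c x s1 s2 : ~~ odd (size s1) ->
  walk c x (s1 ++ s2) -> last x (s1 ++ s2) = x -> walk c (last x s1) (s2 ++ s1).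
Proof.
move=> ev wk; move: (walk_even wk); rewrite size_cat oddD (negbTE ev) /= => ev2.
move: wk; rewrite walk_cat // last_cat => /andP[w1 w2] e.
by rewrite walk_cat // w2 e.
Qed.
End Walks.

(** * Decision trees *)

(* Ask branches on the colour (red first) of a triple of numbered vertices. A leaf names a walk
   all of whose edges are known to have the given colour (true is red): a red walk must contradict
   rigidity and a blue one must be of the wanted kind. The trees below were found by computer. *)
Inductive tableau :=
  | Leaf of bool & seq nat
  | Ask of nat & nat & nat & tableau & tableau.

Definition known (asg : seq (bool * (nat * nat * nat))) b i j k :=
  [|| (b, (i, j, k)) \in asg, (b, (i, k, j)) \in asg, (b, (j, i, k)) \in asg,
      (b, (j, k, i)) \in asg, (b, (k, i, j)) \in asg | (b, (k, j, i)) \in asg].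

Fixpoint closes (ok : bool -> nat -> seq nat -> bool) asg t :=
  match t with
  | Leaf b l => if l is i :: s then ok b i s && walk (known asg b) i s else false
  | Ask i j k tr tb => closes ok ((true, (i, j, k)) :: asg) tr &&
                       closes ok ((false, (i, j, k)) :: asg) tb
  end.

(** Following the true colours down the tree ends at a leaf all of whose recorded answers are
    correct. *)
Lemma closesP (c : nat -> nat -> nat -> bool) ok asg t : sym3 c ->
  (forall b i j k, (b, (i, j, k)) \in asg -> c i j k = b) -> closes ok asg t ->
  exists b i s, ok b i s /\ walk (fun i j k => c i j k == b) i s.
Proof.
move=> [h1 h2]; elim: t asg => [b [|i s] //|i j k tr IHr tb IHb] asg hasg /=.
  case/andP=> h3 h4; exists b, i, s; split=> //.
  apply: sub_walk h4 => x y z; case/or4P=> [/hasg <- //|/hasg <-|/hasg <-|].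
  - by rewrite h2.
  - by rewrite h1.
  by case/or3P=> /hasg <-; rewrite 1?h1 1?h2 1?h1 1?h2.
case/andP=> hr hb; case e: (c i j k); [apply: IHr hr|apply: IHb hb] => b x y z;
  by rewrite inE => /orP[/eqP[-> -> -> ->] //|/hasg].
Qed.

Definition blocks m := [seq (true, (i.*2, i.*2.+1, i.*2.+2)) | i <- iota 0 m].

(* The vertices of a block of m red edges are numbered 0, ..., 2m, the joints being even, and
   those of W are numbered from 2m + 1. *)
Definition stretches m N i s :=
  [&& ~~ odd i, ~~ odd (last i s), i < last i s <= m.*2, size s == (last i s - i).+2,
      uniq s & all (fun v => (i < v <= last i s) || (m.*2 < v < N)) s].

(* (k, u, w, X) asks for a blue lpath with k edges from u to w in X. *)
Definition target := (nat * nat * nat * seq nat)%type.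

Definition reaches (g : target) i s :=
  let: (k, u, w, X) := g in
  [&& i == u, last u s == w, size s == k.*2, uniq s & all (mem (w :: X)) s].

Definition closed_tableau m N asg (gs : seq target) t :=
  closes (fun b i s => if b then stretches m N i s else has (fun g => reaches g i s) gs)
    (blocks m ++ asg) t.

Lemma uniq_map_inj (U V : eqType) (f : U -> V) (l : seq U) :
  uniq (map f l) -> {in l &, injective f}.
Proof.
elim: l => // a l IH /= /andP[na un] i j; rewrite !inE.
case/orP=> [/eqP->|il] /orP[/eqP->|jl] // e; last exact: IH.
  by rewrite e map_f in na.
by rewrite -e map_f in na.
Qed.

Lemma uniq_map_nth (U : eqType) (y : U) (l : seq U) (s : seq nat) :
  uniq l -> all (fun i => i < size l) s -> uniq s -> uniq (map (nth y l) s).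
Proof.
move=> ul /allP bd us; rewrite map_inj_in_uniq // => i j /bd hi /bd hj /eqP.
by rewrite nth_uniq // => /eqP.
Qed.

Section Local.
Variables (T : eqType) (c : T -> T -> T -> bool) (x : T) (p W : seq T).

Let f := nth x (x :: p ++ W).

(** Number 0 is left out because [x] is also the last vertex of [p] when the block is a whole
    cycle. *)
Lemma nth_block_inj i j : uniq (p ++ W) -> 0 < i < (size (p ++ W)).+1 ->
  0 < j < (size (p ++ W)).+1 -> f i = f j -> i = j.
Proof.
case: i j => [|i] [|j] // un /andP[_ hi] /andP[_ hj] /= /eqP.
by rewrite /f /= nth_uniq // => /eqP->.
Qed.

(** The vertices of [s] have positive numbers, so a possible coincidence of [x] with the end of [p]
    does no harm. The block replaced lies between positions [i] and [last i s]. *)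
Lemma stretches_rigid m i s : rigid c x p W -> uniq (p ++ W) -> size p = m.*2 ->
  stretches m (size (p ++ W)).+1 i s ->
  walk (fun i j k => c (f i) (f j) (f k)) i s -> False.
Proof.
move=> rg un sp /and5P[ei ej /andP[ltij lejm] /eqP sz /andP[us /allP sub]].
set j := last i s in ej ltij lejm sz sub *.
rewrite -walk_map => wk.
have inj : {in s &, injective f}.
  move=> a b /sub /= ha /sub /= hb; apply: nth_block_inj => //; move: ha hb;
    by rewrite size_cat; clear -ltij lejm sp; lia.
have fi : last x (take i p) = f i.
  rewrite (last_nth x) size_take_min /f; have -> : minn i (size p) = i by lia.
  rewrite -cat_cons nth_cat /= ltnS ifT; last by lia.
  by case: (i) (ltij) => // i' _ /=; rewrite nth_take.
have eqp : p = take i p ++ take (j - i) (drop i p) ++ drop j p.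
  rewrite -{1}(cat_take_drop i p) -{1}(cat_take_drop (j - i) (drop i p)) drop_drop.
  by rewrite subnK //; lia.
have sz2 : size (take (j - i) (drop i p)) = j - i.
  by rewrite size_takel // size_drop; lia.
apply: (rg (take i p) (take (j - i) (drop i p)) (drop j p) (map f s) eqp).
- by rewrite size_takel //; lia.
- by rewrite sz2; lia.
- by rewrite sz2; lia.
- by rewrite fi.
- rewrite fi last_map -/j (last_nth x) sz2 -/j.
  case: (j - i) (ltij) (subnK (ltnW ltij)) => [|d] h e; first by lia.
  rewrite /= nth_take // nth_drop -e /f /= addnC nth_cat ifT //.
  by lia.
- by rewrite size_map sz2.
- by rewrite map_inj_in_uniq.
- move=> _ /mapP[v /sub /= hv ->]; rewrite mem_cat; case/orP: hv => /andP[h1 h2].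
    apply/orP; left; apply/(nthP x); exists (v - i.+1); first by rewrite sz2; lia.
    rewrite nth_take; last by lia.
    rewrite nth_drop /f; case: v h1 h2 => // v h1 h2 /=.
    rewrite nth_cat ifT; last by lia.
    by congr nth; lia.
  apply/orP; right; case: v h1 h2 => // v h1 h2; rewrite /f /= nth_cat ifF; last by lia.
  by apply: mem_nth; move: h2; rewrite size_cat; lia.
Qed.

(** Rigidity rules out the red leaves, so a blue leaf is reached. A target that uses number 0 has to
    come with the distinctness of its vertices, since [x] may recur in [p]. *)
Lemma tableau_lpath m asg gs t : sym3 c -> size p = m.*2 -> walk c x p ->
  rigid c x p W -> uniq (p ++ W) ->
  (forall b i j k, (b, (i, j, k)) \in asg -> c (f i) (f j) (f k) = b) ->
  (forall g, g \in gs -> all (fun i => i < (size (p ++ W)).+1) (g.1.2 :: g.2) /\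
     (0 \notin g.1.2 :: g.2 \/ uniq (map f (g.1.2 :: g.2)))) ->
  closed_tableau m (size (p ++ W)).+1 asg gs t ->
  exists2 g, g \in gs & lpath (neg3 c) g.1.1.1 (f g.1.1.2) (f g.1.2) (map f g.2).
Proof.
move=> hs sp wk rg un hasg hgs.
have hs' : sym3 (fun i j k => c (f i) (f j) (f k)) by case: hs => h1 h2; split=> *.
case/(closesP hs') => [b i j k|b [i [s [hok wks]]]].
  rewrite mem_cat => /orP[/mapP[d]|/hasg //].
  rewrite mem_iota add0n => /andP[_ ltd] [-> -> -> ->].
  have fE e : e <= m.*2 -> f e = nth x (x :: p) e.
    by rewrite /f -cat_cons nth_cat /= sp ltnS => ->.
  by rewrite !fE ?walk_nth ?sp //; lia.
case: b hok wks => [st wks|/hasP[g gin]].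
  case: (stretches_rigid rg un sp st).
  by apply: sub_walk wks => ? ? ?; rewrite eqb_id.
case: g gin => [[[k u] w] X] gin /and5P[/eqP -> /eqP lu /eqP sz us /allP sub] wks.
exists (k, u, w, X) => //; have [/allP bd ze] := hgs _ gin.
rewrite /= in bd ze *.
exists (map f s); split; rewrite ?last_map ?lu ?size_map //.
- rewrite walk_map; apply: sub_walk wks => a b d; rewrite /neg3.
  by case: c.
- rewrite map_inj_in_uniq // => a b /sub ha /sub hb.
  have [la lb] := (bd _ ha, bd _ hb).
  case: ze => [n0|/(@uniq_map_inj _ _ f (w :: X)) inj]; last exact: inj.
  by apply: nth_block_inj => //; [rewrite la andbT lt0n|rewrite lb andbT lt0n];
    apply: contraNneq n0 => <-.
- move=> _ /mapP[v /sub hv ->]; move: hv; rewrite !inE => /orP[/eqP->|vX].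
    by rewrite eqxx.
  by rewrite map_f ?orbT.
Qed.
End Local.

Definition hexagon_tableau : tableau :=
 (Ask 0 1 2
 (Ask 2 6 5
 (Ask 5 4 1
  (Leaf true [:: 1; 0; 2; 6; 5; 4; 1])
  (Ask 6 4 0
   (Leaf true [:: 0; 1; 2; 5; 6; 4; 0])
   (Ask 5 3 0
    (Leaf true [:: 0; 1; 2; 6; 5; 3; 0])
    (Leaf false [:: 0; 3; 5; 1; 4; 6; 0]))))
 (Ask 4 0 6
  (Ask 2 3 4
   (Leaf true [:: 0; 1; 2; 3; 4; 6; 0])
   (Ask 1 5 4
    (Leaf true [:: 0; 2; 1; 5; 4; 6; 0])
    (Leaf false [:: 2; 3; 4; 1; 5; 6; 2])))
  (Ask 5 1 4
   (Ask 0 3 5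
    (Leaf true [:: 0; 2; 1; 4; 5; 3; 0])
    (Leaf false [:: 0; 3; 5; 2; 6; 4; 0]))
   (Leaf false [:: 4; 0; 6; 2; 5; 1; 4]))))
 (Ask 2 6 5
 (Ask 4 0 6
  (Ask 5 1 4
   (Leaf true [:: 4; 0; 6; 2; 5; 1; 4])
   (Ask 0 3 5
    (Leaf true [:: 0; 3; 5; 2; 6; 4; 0])
    (Leaf false [:: 0; 2; 1; 4; 5; 3; 0])))
  (Ask 2 3 4
   (Ask 1 5 4
    (Leaf true [:: 2; 3; 4; 1; 5; 6; 2])
    (Leaf false [:: 0; 2; 1; 5; 4; 6; 0]))
   (Leaf false [:: 0; 1; 2; 3; 4; 6; 0])))
 (Ask 5 4 1
  (Ask 6 4 0
   (Ask 5 3 0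
    (Leaf true [:: 0; 3; 5; 1; 4; 6; 0])
    (Leaf false [:: 0; 1; 2; 6; 5; 3; 0]))
   (Leaf false [:: 0; 1; 2; 5; 6; 4; 0]))
  (Leaf false [:: 1; 0; 2; 6; 5; 4; 1])))).

Definition inner_left_tableau : tableau :=
 (Ask 1 6 2
 (Leaf true [:: 0; 5; 1; 6; 2])
 (Ask 1 7 3
  (Leaf true [:: 0; 5; 1; 7; 3; 2; 4])
  (Leaf false [:: 6; 2; 1; 3; 7]))).

Definition inner_right_tableau : tableau :=
 (Ask 1 7 3
 (Leaf true [:: 0; 2; 1; 7; 3; 5; 4])
 (Ask 2 6 3
  (Leaf true [:: 0; 1; 2; 6; 3; 5; 4])
  (Leaf false [:: 6; 2; 3; 1; 7]))).

Definition bad_pairs3_tableau : tableau :=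
 (Ask 4 2 7
 (Ask 5 3 0
  (Ask 5 2 1
   (Leaf true [:: 0; 3; 5; 1; 2; 7; 4])
   (Leaf false [:: 5; 2; 1; 0; 6]))
  (Leaf false [:: 5; 3; 0; 1; 6]))
 (Leaf false [:: 6; 3; 4; 2; 7])).

Definition bad_pairs4_tableau : tableau :=
 (Ask 7 1 4
 (Ask 0 3 6
  (Ask 1 2 6
   (Leaf true [:: 0; 3; 6; 2; 1; 7; 4])
   (Leaf false [:: 5; 0; 1; 2; 6]))
  (Leaf false [:: 5; 1; 0; 3; 6]))
 (Leaf false [:: 7; 1; 4; 3; 8])).

Definition spare_edge_tableau : tableau :=
 (Ask 3 1 0
 (Ask 3 5 2
  (Leaf true [:: 0; 1; 3; 5; 2])
  (Ask 1 4 2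
   (Leaf true [:: 0; 3; 1; 4; 2])
   (Leaf false [:: 3; 5; 2; 1; 4])))
 (Ask 0 5 4
  (Ask 1 2 4
   (Leaf true [:: 0; 5; 4; 1; 2])
   (Leaf false [:: 3; 0; 1; 2; 4]))
  (Leaf false [:: 3; 1; 0; 5; 4]))).

Definition spare_pair_tableau : tableau :=
 (Ask 2 6 8
 (Ask 8 5 4
  (Leaf true [:: 0; 1; 2; 6; 8; 5; 4])
  (Ask 0 7 6
   (Leaf true [:: 0; 7; 6; 8; 2])
   (Ask 0 1 6
    (Leaf true [:: 0; 1; 6; 8; 2])
    (Ask 4 3 7
     (Ask 8 7 1
      (Leaf true [:: 0; 2; 1; 8; 7; 3; 4])
      (Leaf false [:: 5; 4; 8; 7; 1; 0; 6]))
     (Leaf false [:: 5; 8; 4; 3; 7; 0; 6])))))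
 (Ask 0 7 5
  (Ask 5 8 2
   (Leaf true [:: 0; 7; 5; 8; 2])
   (Ask 5 8 3
    (Leaf true [:: 0; 7; 5; 8; 3; 2; 4])
    (Ask 8 7 0
     (Ask 7 6 2
      (Leaf true [:: 0; 8; 7; 6; 2])
      (Ask 8 1 2
       (Leaf true [:: 0; 7; 8; 1; 2])
       (Leaf false [:: 5; 3; 8; 1; 2; 7; 6])))
     (Ask 0 1 6
      (Ask 1 8 2
       (Leaf true [:: 0; 6; 1; 8; 2])
       (Ask 6 7 2
        (Leaf true [:: 0; 1; 6; 7; 2])
        (Leaf false [:: 5; 3; 8; 1; 2; 7; 6])))
      (Leaf false [:: 5; 2; 8; 7; 0; 1; 6])))))
  (Ask 0 1 8
   (Ask 1 6 2
    (Leaf true [:: 0; 8; 1; 6; 2])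
    (Ask 8 7 2
     (Leaf true [:: 0; 1; 8; 7; 2])
     (Leaf false [:: 5; 0; 7; 8; 2; 1; 6])))
   (Leaf false [:: 5; 7; 0; 1; 8; 2; 6])))).

Definition triangle_tableau : tableau :=
 (Ask 0 6 5
 (Ask 5 1 3
  (Leaf true [:: 0; 6; 5; 1; 3; 2; 4])
  (Ask 5 1 2
   (Leaf true [:: 0; 6; 5; 1; 2])
   (Ask 6 7 2
    (Leaf true [:: 0; 5; 6; 7; 2])
    (Ask 5 7 3
     (Leaf true [:: 0; 6; 5; 7; 3; 2; 4])
     (Leaf false [:: 5; 1; 2; 6; 7; 3; 5])))))
 (Ask 2 5 7
  (Ask 7 6 4
   (Leaf true [:: 0; 1; 2; 5; 7; 6; 4])
   (Ask 5 3 4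
    (Leaf true [:: 0; 1; 2; 7; 5; 3; 4])
    (Leaf false [:: 5; 0; 6; 7; 4; 3; 5])))
  (Ask 2 1 6
   (Ask 0 5 1
    (Leaf true [:: 0; 5; 1; 6; 2])
    (Ask 0 7 1
     (Leaf true [:: 0; 7; 1; 6; 2])
     (Ask 0 6 2
      (Ask 1 6 5
       (Ask 5 3 4
        (Leaf true [:: 0; 2; 6; 1; 5; 3; 4])
        (Ask 6 7 4
         (Leaf true [:: 0; 2; 1; 5; 6; 7; 4])
         (Leaf false [:: 5; 0; 6; 7; 4; 3; 5])))
       (Leaf false [:: 5; 2; 7; 0; 1; 6; 5]))
      (Leaf false [:: 5; 1; 0; 6; 2; 7; 5]))))
   (Leaf false [:: 5; 7; 2; 1; 6; 0; 5])))).

Definition left_or_even_tableau : tableau :=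
 (Ask 7 3 0
 (Ask 0 3 8
  (Ask 1 2 8
   (Ask 7 2 1
    (Ask 7 3 1
     (Ask 2 9 4
      (Leaf true [:: 0; 3; 8; 1; 2; 9; 4; 5; 6])
      (Ask 2 8 5
       (Leaf true [:: 0; 3; 7; 1; 2; 8; 5; 4; 6])
       (Ask 1 10 5
        (Leaf true [:: 0; 8; 3; 7; 1; 10; 5; 4; 6])
        (Leaf false [:: 10; 1; 5; 8; 2; 9; 4; 3; 7]))))
     (Leaf false [:: 7; 3; 1; 0; 8]))
    (Leaf false [:: 7; 2; 1; 0; 8]))
   (Leaf false [:: 7; 0; 1; 2; 8]))
  (Leaf false [:: 7; 1; 0; 3; 8]))
 (Leaf false [:: 7; 3; 0; 1; 8])).

Definition left_or_even_closed_tableau : tableau :=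
 (Ask 7 3 0
 (Ask 7 3 1
  (Ask 0 3 8
   (Ask 1 2 8
    (Ask 1 3 8
     (Ask 3 9 5
      (Leaf true [:: 0; 2; 1; 7; 3; 9; 5; 4; 6])
      (Ask 7 8 4
       (Leaf true [:: 0; 2; 1; 3; 7; 8; 4])
       (Ask 2 7 5
        (Leaf true [:: 0; 3; 8; 1; 2; 7; 5; 4; 6])
        (Ask 1 9 4
         (Leaf true [:: 0; 7; 3; 8; 1; 9; 4])
         (Leaf false [:: 7; 2; 5; 3; 9; 1; 4; 8; 7])))))
     (Leaf false [:: 7; 0; 1; 3; 8]))
    (Leaf false [:: 7; 0; 1; 2; 8]))
   (Leaf false [:: 7; 1; 0; 3; 8]))
  (Leaf false [:: 7; 3; 1; 0; 8]))
 (Leaf false [:: 7; 3; 0; 1; 8])).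

Definition left_or_odd_tableau : tableau :=
 (Ask 9 3 0
 (Ask 0 3 10
  (Ask 1 3 10
   (Ask 1 2 10
    (Ask 10 9 5
     (Leaf true [:: 0; 2; 1; 3; 10; 9; 5; 4; 6])
     (Ask 10 12 6
      (Leaf true [:: 0; 9; 3; 4; 2; 1; 10; 12; 6; 7; 8])
      (Ask 2 11 4
       (Leaf true [:: 0; 3; 10; 1; 2; 11; 4])
       (Ask 1 11 6
        (Leaf true [:: 0; 9; 3; 4; 2; 10; 1; 11; 6])
        (Leaf false [:: 13; 3; 4; 2; 11; 1; 6; 12; 10; 5; 9])))))
    (Leaf false [:: 9; 0; 1; 2; 10]))
   (Leaf false [:: 9; 0; 1; 3; 10]))
  (Leaf false [:: 9; 1; 0; 3; 10]))
 (Leaf false [:: 9; 3; 0; 1; 10])).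

Definition left_or_odd_closed_tableau : tableau :=
 (Ask 1 2 10
 (Ask 0 2 10
  (Ask 0 3 10
   (Ask 9 3 0
    (Ask 9 2 1
     (Ask 1 9 4
      (Leaf true [:: 0; 3; 10; 2; 1; 9; 4])
      (Ask 10 12 6
       (Leaf true [:: 0; 9; 3; 4; 2; 1; 10; 12; 6])
       (Ask 2 10 5
        (Leaf true [:: 0; 3; 9; 1; 2; 10; 5; 4; 6])
        (Ask 1 11 6
         (Leaf true [:: 0; 10; 3; 4; 2; 9; 1; 11; 6])
         (Ask 9 3 5
          (Leaf true [:: 0; 10; 2; 1; 9; 3; 5; 4; 6])
          (Leaf false [:: 9; 4; 1; 11; 6; 12; 10; 2; 5; 3; 9]))))))
     (Leaf false [:: 9; 2; 1; 0; 10]))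
    (Leaf false [:: 9; 3; 0; 1; 10]))
   (Leaf false [:: 9; 1; 0; 3; 10]))
  (Leaf false [:: 9; 1; 0; 2; 10]))
 (Leaf false [:: 9; 0; 1; 2; 10])).

Definition two_pairs_tableau : tableau :=
 (Ask 1 3 10
 (Ask 9 2 0
  (Ask 9 3 0
   (Ask 1 11 6
    (Leaf true [:: 0; 9; 2; 4; 3; 10; 1; 11; 6])
    (Ask 10 5 6
     (Leaf true [:: 0; 9; 2; 4; 3; 1; 10; 5; 6])
     (Ask 10 2 4
      (Leaf true [:: 0; 9; 3; 1; 10; 2; 4])
      (Leaf false [:: 9; 3; 4; 2; 10; 5; 6; 1; 11]))))
   (Leaf false [:: 9; 3; 0; 1; 10]))
  (Leaf false [:: 9; 2; 0; 1; 10]))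
 (Leaf false [:: 9; 0; 1; 3; 10])).

(** * Local configurations *)

Section LocalConfigurations.
Variables (T : eqType) (c : T -> T -> T -> bool).
Hypothesis hc : sym3 c.
Implicit Types (x y z u v w : T) (p q s W : seq T).

Notation blue := (neg3 c).

Ltac by_tableau A G t :=
  match goal with
  | hw : is_true (walk c ?x ?p), hr : rigid c ?x ?p ?W, un : is_true (uniq _) |- _ =>
    have [] := @tableau_lpath T c x p W (size p)./2 A G t hc erefl hw hr un;
    [ let b := fresh in let i := fresh in let j := fresh in let k := fresh in
      move=> b i j k; rewrite ?in_nil ?inE; do ?[case/orP];
      try (move/eqP=> [-> -> -> ->] /=); try by [];
      try (apply/negbTE; by auto)
    | let g := fresh in move=> g; rewrite !inE; do ?[case/orP]; move/eqP=> ->;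
      split; try by [];
      try (by left); right; first [eassumption | by apply: uniq_map_nth]
    | by []
    | let g := fresh in move=> g; rewrite !inE; do ?[case/orP]; move/eqP=> -> /= ]
  end.

(** If {b1, u, a2} were red, x, y, b1, u, a2 would replace one edge; if {b1, v, b2} were red, x, y,
    b1, v, b2, a2, a3 would replace two. Both are blue, which gives the path u, a2, b1, b2, v. *)
Lemma inner_of_red_left x b1 a2 b2 a3 y u v :
  let p := [:: b1; a2; b2; a3] in let W := [:: y; u; v] in
  walk c x p -> rigid c x p W -> uniq (p ++ W) -> c x b1 y ->
  lpath blue 2 u v [:: b1; a2; b2].
Proof.
move=> p W hw hr un red.
by by_tableau [:: (true, (0, 1, 5))] [:: (2, 6, 7, [:: 1; 2; 3])] inner_left_tableau.
Qed.

(** The mirror image, with blue path u, a2, b2, b1, v. *)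
Lemma inner_of_red_right x b1 a2 b2 a3 y u v :
  let p := [:: b1; a2; b2; a3] in let W := [:: y; u; v] in
  walk c x p -> rigid c x p W -> uniq (p ++ W) -> c b2 a3 y ->
  lpath blue 2 u v [:: b1; a2; b2].
Proof.
move=> p W hw hr un red.
by by_tableau [:: (true, (3, 4, 5))] [:: (2, 6, 7, [:: 1; 2; 3])] inner_right_tableau.
Qed.

(* Pairs of consecutive edges that admit no inner path have this property. *)
Definition blue_ends x b1 b2 a3 W := {in W, forall y, ~~ c x b1 y /\ ~~ c b2 a3 y}.

(** Together with [bad_pairs_meet4] this leaves at most one pair of outside vertices with neither a
    left nor a right path: two such pairs could neither share a vertex nor be disjoint. *)
Lemma bad_pairs_meet3 x b1 a2 b2 a3 u v w :
  let p := [:: b1; a2; b2; a3] in let W := [:: u; v; w] in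
  walk c x p -> rigid c x p W -> uniq (x :: p ++ W) -> blue_ends x b1 b2 a3 W ->
  [\/ lpath blue 2 u v [:: x; b1; a2; b2], lpath blue 2 u v [:: b1; a2; b2; a3],
      lpath blue 2 v w [:: x; b1; a2; b2] | lpath blue 2 v w [:: b1; a2; b2; a3]].
Proof.
move=> p W hw hr un' hN; have un : uniq (p ++ W) by case/andP: un'.
have [n1 n2] := hN u (mem_head _ _).
have [n3 n4] : ~~ c x b1 v /\ ~~ c b2 a3 v by apply: hN; rewrite !inE eqxx orbT.
have [n5 n6] : ~~ c x b1 w /\ ~~ c b2 a3 w by apply: hN; rewrite !inE eqxx !orbT.
by_tableau [:: (false, (0, 1, 5)); (false, (3, 4, 5)); (false, (0, 1, 6));
    (false, (3, 4, 6)); (false, (0, 1, 7)); (false, (3, 4, 7))]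
  [:: (2, 5, 6, [:: 0; 1; 2; 3]); (2, 5, 6, [:: 1; 2; 3; 4]);
      (2, 6, 7, [:: 0; 1; 2; 3]); (2, 6, 7, [:: 1; 2; 3; 4])] bad_pairs3_tableau.
- by constructor 1.
- by constructor 2.
- by constructor 3.
- by constructor 4.
Qed.

Lemma bad_pairs_meet4 x b1 a2 b2 a3 u v w z :
  let p := [:: b1; a2; b2; a3] in let W := [:: u; v; w; z] in
  walk c x p -> rigid c x p W -> uniq (x :: p ++ W) -> blue_ends x b1 b2 a3 W ->
  [\/ lpath blue 2 u v [:: x; b1; a2; b2], lpath blue 2 u v [:: b1; a2; b2; a3],
      lpath blue 2 w z [:: x; b1; a2; b2] | lpath blue 2 w z [:: b1; a2; b2; a3]].
Proof.
move=> p W hw hr un' hN; have un : uniq (p ++ W) by case/andP: un'.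
have [n1 n2] := hN u (mem_head _ _).
have [n3 n4] : ~~ c x b1 v /\ ~~ c b2 a3 v by apply: hN; rewrite !inE eqxx orbT.
have [n5 n6] : ~~ c x b1 w /\ ~~ c b2 a3 w by apply: hN; rewrite !inE eqxx !orbT.
have [n7 n8] : ~~ c x b1 z /\ ~~ c b2 a3 z by apply: hN; rewrite !inE eqxx !orbT.
by_tableau [:: (false, (0, 1, 5)); (false, (3, 4, 5)); (false, (0, 1, 6));
    (false, (3, 4, 6)); (false, (0, 1, 7)); (false, (3, 4, 7)); (false, (0, 1, 8));
    (false, (3, 4, 8))]
  [:: (2, 5, 6, [:: 0; 1; 2; 3]); (2, 5, 6, [:: 1; 2; 3; 4]);
      (2, 7, 8, [:: 0; 1; 2; 3]); (2, 7, 8, [:: 1; 2; 3; 4])] bad_pairs4_tableau.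
- by constructor 1.
- by constructor 2.
- by constructor 3.
- by constructor 4.
Qed.

(** Closes a chain when both joints of the remaining edge are free: one spare outside vertex buys a
    second blue edge. [spare_pair] does the same for two edges and two spare vertices. *)
Lemma spare_edge x b a u v y :
  let p := [:: b; a] in let W := [:: u; v; y] in
  walk c x p -> rigid c x p W -> uniq (x :: p ++ W) ->
  lpath blue 2 u v [:: x; b; a; y].
Proof.
move=> p W hw hr un'; have un : uniq (p ++ W) by case/andP: un'.
by by_tableau (@nil (bool * (nat * nat * nat))) [:: (2, 3, 4, [:: 0; 1; 2; 5])] spare_edge_tableau.
Qed.

Lemma spare_pair x b1 a2 b2 a3 u v y z :
  let p := [:: b1; a2; b2; a3] in let W := [:: u; v; y; z] in
  walk c x p -> rigid c x p W -> uniq (x :: p ++ W) ->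
  lpath blue 3 u v [:: x; b1; a2; b2; a3; y; z].
Proof.
move=> p W hw hr un'; have un : uniq (p ++ W) by case/andP: un'.
by by_tableau (@nil (bool * (nat * nat * nat)))
  [:: (3, 5, 6, [:: 0; 1; 2; 3; 4; 7; 8])] spare_pair_tableau.
Qed.

(** Serves m = 3, which is too short for a chain with a closing. *)
Lemma triangle_of_pair x b1 a2 b2 a3 u v y :
  let p := [:: b1; a2; b2; a3] in let W := [:: u; v; y] in
  walk c x p -> rigid c x p W -> uniq (x :: p ++ W) ->
  lpath blue 3 u u [:: x; b1; a2; b2; a3; v; y].
Proof.
move=> p W hw hr un'; have un : uniq (p ++ W) by case/andP: un'.
by by_tableau (@nil (bool * (nat * nat * nat)))
  [:: (3, 5, 5, [:: 0; 1; 2; 3; 4; 6; 7])] triangle_tableau.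
Qed.

(** The longer path avoids both [x] and [a4], because the chain on the rest of the cycle may use
    these joints. *)
Lemma left_or_even x b1 a2 b2 a3 b3 a4 u v y w :
  let p := [:: b1; a2; b2; a3; b3; a4] in let W := [:: u; v; y; w] in
  walk c x p -> rigid c x p W -> uniq (p ++ W) -> uniq [:: v; x; b1; a2; b2] ->
  blue_ends x b1 b2 a3 W ->
  lpath blue 2 u v [:: x; b1; a2; b2] \/
  lpath blue 4 w u [:: b1; a2; b2; a3; b3; v; y].
Proof.
move=> p W hw hr un un' hN.
have [n1 n2] := hN u (mem_head _ _).
have [n3 n4] : ~~ c x b1 v /\ ~~ c b2 a3 v by apply: hN; rewrite !inE eqxx orbT.
have [n5 n6] : ~~ c x b1 y /\ ~~ c b2 a3 y by apply: hN; rewrite !inE eqxx !orbT.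
have [n7 n8] : ~~ c x b1 w /\ ~~ c b2 a3 w by apply: hN; rewrite !inE eqxx !orbT.
by_tableau [:: (false, (0, 1, 7)); (false, (3, 4, 7)); (false, (0, 1, 8));
    (false, (3, 4, 8)); (false, (0, 1, 9)); (false, (3, 4, 9)); (false, (0, 1, 10));
    (false, (3, 4, 10))]
  [:: (2, 7, 8, [:: 0; 1; 2; 3]); (4, 10, 7, [:: 1; 2; 3; 4; 5; 8; 9])] left_or_even_tableau.
- by left.
- by right.
Qed.

(** The case m = 4, without a chain. For n = 4 the three edges are the whole red cycle and [x = a4],
    so [x] is only required to differ from [v] and the vertices next to it. *)
Lemma left_or_even_closed x b1 a2 b2 a3 b3 a4 u v y :
  let p := [:: b1; a2; b2; a3; b3; a4] in let W := [:: u; v; y] in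
  walk c x p -> rigid c x p W -> uniq (p ++ W) -> uniq [:: v; x; b1; a2; b2] ->
  blue_ends x b1 b2 a3 W ->
  lpath blue 2 u v [:: x; b1; a2; b2] \/
  lpath blue 4 u u [:: b1; a2; b2; a3; b3; v; y].
Proof.
move=> p W hw hr un un' hN.
have [n1 n2] := hN u (mem_head _ _).
have [n3 n4] : ~~ c x b1 v /\ ~~ c b2 a3 v by apply: hN; rewrite !inE eqxx orbT.
have [n5 n6] : ~~ c x b1 y /\ ~~ c b2 a3 y by apply: hN; rewrite !inE eqxx !orbT.
by_tableau [:: (false, (0, 1, 7)); (false, (3, 4, 7)); (false, (0, 1, 8));
    (false, (3, 4, 8)); (false, (0, 1, 9)); (false, (3, 4, 9))]
  [:: (2, 7, 8, [:: 0; 1; 2; 3]); (4, 7, 7, [:: 1; 2; 3; 4; 5; 8; 9])] left_or_even_closed_tableau.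
- by left.
- by right.
Qed.

(** For odd m the pair is followed by two edges instead of one, and one more spare vertex is
    available. *)
Lemma left_or_odd x b1 a2 b2 a3 b3 a4 b4 a5 u v y z w :
  let p := [:: b1; a2; b2; a3; b3; a4; b4; a5] in let W := [:: u; v; y; z; w] in
  walk c x p -> rigid c x p W -> uniq (p ++ W) -> uniq [:: v; x; b1; a2; b2] ->
  blue_ends x b1 b2 a3 W ->
  lpath blue 2 u v [:: x; b1; a2; b2] \/
  lpath blue 5 w u [:: b1; a2; b2; a3; b3; a4; b4; v; y; z].
Proof.
move=> p W hw hr un un' hN.
have [n1 n2] := hN u (mem_head _ _).
have [n3 n4] : ~~ c x b1 v /\ ~~ c b2 a3 v by apply: hN; rewrite !inE eqxx orbT.
have [n5 n6] : ~~ c x b1 y /\ ~~ c b2 a3 y by apply: hN; rewrite !inE eqxx !orbT.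
have [n7 n8] : ~~ c x b1 z /\ ~~ c b2 a3 z by apply: hN; rewrite !inE eqxx !orbT.
have [n9 n10] : ~~ c x b1 w /\ ~~ c b2 a3 w by apply: hN; rewrite !inE eqxx !orbT.
by_tableau [:: (false, (0, 1, 9)); (false, (3, 4, 9)); (false, (0, 1, 10));
    (false, (3, 4, 10)); (false, (0, 1, 11)); (false, (3, 4, 11)); (false, (0, 1, 12));
    (false, (3, 4, 12)); (false, (0, 1, 13)); (false, (3, 4, 13))]
  [:: (2, 9, 10, [:: 0; 1; 2; 3]); (5, 13, 9, [:: 1; 2; 3; 4; 5; 6; 7; 10; 11; 12])]
  left_or_odd_tableau.
- by left.
- by right.
Qed.

Lemma left_or_odd_closed x b1 a2 b2 a3 b3 a4 b4 a5 u v y z :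
  let p := [:: b1; a2; b2; a3; b3; a4; b4; a5] in let W := [:: u; v; y; z] in
  walk c x p -> rigid c x p W -> uniq (p ++ W) -> uniq [:: v; x; b1; a2; b2] ->
  blue_ends x b1 b2 a3 W ->
  lpath blue 2 u v [:: x; b1; a2; b2] \/
  lpath blue 5 u u [:: b1; a2; b2; a3; b3; a4; b4; v; y; z].
Proof.
move=> p W hw hr un un' hN.
have [n1 n2] := hN u (mem_head _ _).
have [n3 n4] : ~~ c x b1 v /\ ~~ c b2 a3 v by apply: hN; rewrite !inE eqxx orbT.
have [n5 n6] : ~~ c x b1 y /\ ~~ c b2 a3 y by apply: hN; rewrite !inE eqxx !orbT.
have [n7 n8] : ~~ c x b1 z /\ ~~ c b2 a3 z by apply: hN; rewrite !inE eqxx !orbT.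
by_tableau [:: (false, (0, 1, 9)); (false, (3, 4, 9)); (false, (0, 1, 10));
    (false, (3, 4, 10)); (false, (0, 1, 11)); (false, (3, 4, 11)); (false, (0, 1, 12));
    (false, (3, 4, 12))]
  [:: (2, 9, 10, [:: 0; 1; 2; 3]); (5, 9, 9, [:: 1; 2; 3; 4; 5; 6; 7; 10; 11; 12])]
  left_or_odd_closed_tableau.
- by left.
- by right.
Qed.

(* Keeps both end joints free when the first pair has no left path and the second no inner one. *)
Lemma two_pairs x b1 a2 b2 a3 b3 a4 b4 a5 u v w :
  let p := [:: b1; a2; b2; a3; b3; a4; b4; a5] in let W := [:: u; v; w] in
  walk c x p -> rigid c x p W -> uniq (x :: p ++ W) ->
  blue_ends x b1 b2 a3 W -> blue_ends a3 b3 b4 a5 W ->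
  [\/ lpath blue 2 u v [:: x; b1; a2; b2], lpath blue 2 v w [:: b3; a4; b4] |
      lpath blue 4 u w [:: b1; a2; b2; a3; b3; a4; b4; v]].
Proof.
move=> p W hw hr un' hN hM; have un : uniq (p ++ W) by case/andP: un'.
have [n1 n2] := hN u (mem_head _ _).
have [n3 n4] : ~~ c x b1 v /\ ~~ c b2 a3 v by apply: hN; rewrite !inE eqxx orbT.
have [n5 n6] : ~~ c x b1 w /\ ~~ c b2 a3 w by apply: hN; rewrite !inE eqxx !orbT.
have [m1 m2] := hM u (mem_head _ _).
have [m3 m4] : ~~ c a3 b3 v /\ ~~ c b4 a5 v by apply: hM; rewrite !inE eqxx orbT.
have [m5 m6] : ~~ c a3 b3 w /\ ~~ c b4 a5 w by apply: hM; rewrite !inE eqxx !orbT.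
by_tableau [:: (false, (0, 1, 9)); (false, (3, 4, 9)); (false, (0, 1, 10));
    (false, (3, 4, 10)); (false, (0, 1, 11)); (false, (3, 4, 11)); (false, (4, 5, 9));
    (false, (7, 8, 9)); (false, (4, 5, 10)); (false, (7, 8, 10)); (false, (4, 5, 11));
    (false, (7, 8, 11))]
  [:: (2, 9, 10, [:: 0; 1; 2; 3]); (2, 10, 11, [:: 5; 6; 7]);
      (4, 9, 11, [:: 1; 2; 3; 4; 5; 6; 7; 10])] two_pairs_tableau.
- by constructor 1.
- by constructor 2.
- by constructor 3.
Qed.
End LocalConfigurations.

(** The base n = m = 3 of the induction. Every leaf of the tree is a closed walk with three edges,
    of either colour. *)
Lemma seven_vertices (T : eqType) (c : T -> T -> T -> bool) (V : seq T) :
  sym3 c -> uniq V -> 7 <= size V -> cyc c V 3 \/ cyc (neg3 c) V 3.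
Proof.
case: V => [|x V] // hc un sz; pose f := nth x (x :: V).
pose hexagon := fun (b : bool) i s =>
  [&& last i s == i, size s == 6, uniq s & all (fun v => v < 7) s].
have hs : sym3 (fun i j k => c (f i) (f j) (f k)) by case: hc => h1 h2; split=> *.
have [//|//|b [i [s [/and4P[/eqP ls /eqP ss us /allP bd] wk]]]] :=
  @closesP _ hexagon [::] hexagon_tableau hs.
have sub y : y \in map f s -> y \in x :: V.
  by case/mapP=> j /bd hj ->; apply: mem_nth; apply: leq_trans sz.
have usf : uniq (map f s).
  by apply: uniq_map_nth => //; apply/allP => j /bd hj; apply: leq_trans sz.
case: b wk => wk; [left|right]; exists (f i), (map f s); split;
  rewrite ?last_map ?ls ?size_map ?ss // walk_map;
  by apply: sub_walk wk => j k l; rewrite /neg3; case: (c _ _ _).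
Qed.

(** * Chains of blue paths *)

Section Chains.
Variables (T : eqType) (c : T -> T -> T -> bool).
Hypothesis hc : sym3 c.
Implicit Types (x y z u v w : T) (p q s W ws zs : seq T).

Notation blue := (neg3 c).

Ltac sub_lists := let y := fresh "y" in
  move=> y; rewrite ?(inE, mem_cat); do ?[case/orP]; by move=> ->; rewrite ?orbT.

(** In the uses, [A] and [B] are disjoint parts of the red cycle and [A'], [B'] lie outside it, so
    the only overlap to exclude separately is between [A'] and [B']. *)
Lemma lpath_join k1 k2 u v w S1 S2 A A' B B' W (d : T -> T -> T -> bool) :
  lpath d k1 u v S1 -> lpath d k2 v w S2 -> uniq (A ++ B ++ W) ->
  {subset v :: S1 <= A ++ A'} -> {subset w :: S2 <= B ++ B'} ->
  {subset A' <= W} -> {subset B' <= W} -> uniq (A' ++ B') ->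
  lpath d (k1 + k2) u w (A ++ B ++ A' ++ B').
Proof.
move=> l1 l2; rewrite !cat_uniq !has_cat !negb_or.
move=> /and5P[_ /andP[/hasPn nAB /hasPn nAW] _ /hasPn nBW _] s1 s2 sA sB.
move=> /and3P[_ /hasPn nAB' _].
apply: lpath_sub (lpath_cat l1 l2 _) => y; last first.
  move=> /s1; rewrite mem_cat => /orP[yA|yA'] /s2; rewrite mem_cat => /orP[yB|yB'].
  - by move/negP: (nAB _ yB).
  - by move/negP: (nAW _ (sB _ yB')).
  - by move/negP: (nBW _ (sA _ yA')).
  - by move/negP: (nAB' _ yB').
rewrite inE mem_cat => yin.
have: (y \in A ++ A') || (y \in B ++ B').
  case/or3P: yin => [/eqP->|y1|y2].
  - by rewrite s1 ?mem_head.
  - by rewrite s1 // inE y1 orbT.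
  - by rewrite s2 ?orbT // inE y2 orbT.
by rewrite !mem_cat; do ?[case/orP]; move=> ->; rewrite ?orbT.
Qed.

Lemma uniq_cat_sub p W W' : uniq (p ++ W) -> uniq W' -> {subset W' <= W} -> uniq (p ++ W').
Proof.
rewrite !cat_uniq => /and3P[-> /hasPn h _] -> sub; rewrite andbT.
by apply/hasPn => y /sub /h.
Qed.

(* The vertex z is the exceptional outside vertex of the pair. *)
Definition inner_pair b1 a2 b2 W z := forall u v, u \in W -> v \in W -> u != v ->
  u != z -> v != z -> lpath blue 2 u v [:: b1; a2; b2].

Definition left_pair W x b1 a2 b2 (a3 : T) z := forall u v, u \in W -> v \in W -> u != v ->
  u != z -> v != z -> lpath blue 2 u v [:: x; b1; a2; b2].

(** The blue ends are recorded in the second case because [two_pairs] relies on them. *)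
Definition good_pair W x b1 a2 b2 a3 z :=
  inner_pair b1 a2 b2 W z \/
  blue_ends c x b1 b2 a3 W /\ forall u v, u \in W -> v \in W -> u != v ->
    u != z -> v != z -> lpath blue 2 u v [:: x; b1; a2; b2] \/
                        lpath blue 2 u v [:: b1; a2; b2; a3].

Lemma inner_or_blue_ends x b1 a2 b2 a3 W :
  let p := [:: b1; a2; b2; a3] in
  walk c x p -> rigid c x p W -> uniq (p ++ W) ->
  (exists z, inner_pair b1 a2 b2 W z) \/ blue_ends c x b1 b2 a3 W.
Proof.
move=> p hw hr un.
have sub3 y u v : y \in W -> u \in W -> v \in W -> {subset [:: y; u; v] <= W}.
  by move=> hy hu hv q; rewrite !inE => /or3P[] /eqP->.
have [/hasP[y yW cy]|/hasPn n1] := boolP (has (c x b1) W).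
  left; exists y => u v uW vW uv uy vy.
  apply: (inner_of_red_left hc hw _ _ cy); first exact: rigid_sub (sub3 _ _ _ _ _ _) hr.
  apply: uniq_cat_sub un _ (sub3 _ _ _ yW uW vW).
  by rewrite /= !inE negb_or uv !(eq_sym y) uy vy.
have [/hasP[y yW cy]|/hasPn n2] := boolP (has (c b2 a3) W).
  left; exists y => u v uW vW uv uy vy.
  apply: (inner_of_red_right hc hw _ _ cy); first exact: rigid_sub (sub3 _ _ _ _ _ _) hr.
  apply: uniq_cat_sub un _ (sub3 _ _ _ yW uW vW).
  by rewrite /= !inE negb_or uv !(eq_sym y) uy vy.
by right=> y yW; rewrite n1 ?n2.
Qed.

(** At most one pair [u0], [v0] of outside vertices admits neither path, so declaring [u0]
    exceptional removes it. *)
Lemma good_pair_exists x b1 a2 b2 a3 W :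
  let p := [:: b1; a2; b2; a3] in
  walk c x p -> rigid c x p W -> uniq (x :: p ++ W) ->
  exists z, good_pair W x b1 a2 b2 a3 z.
Proof.
move=> p hw hr un'; have un : uniq (p ++ W) by case/andP: un'.
have [[z hz]|hN] := inner_or_blue_ends hw hr un; first by exists z; left.
have sym u v S : u \in W -> v \in W -> u != v -> {subset S <= x :: p} ->
    lpath blue 2 u v S -> lpath blue 2 v u S.
  move=> uW vW uv sub; have notin y : y \in W -> y \notin S.
    move=> yW; apply: contraTN un' => /sub yp.
    by rewrite -cat_cons cat_uniq negb_and; apply/orP; right; rewrite negb_and;
      apply/orP; left; rewrite negbK; apply/hasP; exists y.
  by apply: lpath2_sym; rewrite ?notin //; exact: sym3_neg.
have subl : {subset [:: x; b1; a2; b2] <= x :: p} by sub_lists.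
have subr : {subset p <= x :: p} by sub_lists.
have [[u0 [v0 [uW0 vW0 uv0 [nl nr]]]]|none] := classic (exists u v,
  [/\ u \in W, v \in W, u != v & ~ lpath blue 2 u v [:: x; b1; a2; b2] /\
                                 ~ lpath blue 2 u v p]); last first.
  exists x; right; split=> // u v uW vW uv _ _.
  have [|nl] := classic (lpath blue 2 u v [:: x; b1; a2; b2]); first by left.
  have [|nr] := classic (lpath blue 2 u v p); first by right.
  by case: none; exists u, v.
exists u0; right; split=> // u v uW vW uv uu vu.
have use W' : uniq W' -> {subset W' <= W} ->
    [/\ rigid c x p W', uniq (x :: p ++ W') & blue_ends c x b1 b2 a3 W'].
  move=> uW' sub; split; first exact: rigid_sub hr.
    exact: (@uniq_cat_sub (x :: p) W).
  by move=> y /sub; exact: hN.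
(* As [u0] is excluded, the pair [u], [v] meets [u0], [v0] in [v0] only, or not at all. *)
have [e|vu0] := eqVneq v0 u.
  have [|y|h1 h2 h3] := use [:: u0; u; v].
  - by rewrite /= !inE negb_or uv !(eq_sym u0) uu vu.
  - by rewrite !inE => /or3P[] /eqP->.
  subst v0; by case: (bad_pairs_meet3 hc hw h1 h2 h3) => [/nl|/nr|l|r] //; [left|right].
have [e|vv0] := eqVneq v0 v.
  have [|y|h1 h2 h3] := use [:: u0; v; u].
  - by rewrite /= !inE negb_or (eq_sym v) uv !(eq_sym u0) uu vu.
  - by rewrite !inE => /or3P[] /eqP->.
  subst v0; case: (bad_pairs_meet3 hc hw h1 h2 h3) => [/nl|/nr|l|r] //; [left|right].
    by apply: sym l; rewrite // eq_sym.
  by apply: sym r; rewrite // eq_sym.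
have [|y|h1 h2 h3] := use [:: u0; v0; u; v].
- by rewrite /= !inE !negb_or uv uv0 vu0 vv0 !(eq_sym u0) uu vu.
- by rewrite !inE => /or4P[] /eqP->.
by case: (bad_pairs_meet4 hc hw h1 h2 h3) => [/nl|/nr|l|r] //; [left|right].
Qed.

Fixpoint pairs (P : T -> T -> T -> T -> T -> T -> Prop) x p zs := match p, zs with
  | b1 :: a2 :: b2 :: a3 :: p', z :: zs' => P x b1 a2 b2 a3 z /\ pairs P a3 p' zs'
  | [::], [::] => True
  | _, _ => False
  end.

(** A vertex that links two consecutive pairs must differ from the exceptional vertices of both. *)
Fixpoint avoids w ws zs := match ws, zs with
  | w' :: ws', z :: zs' => [/\ w != z, w' != z & avoids w' ws' zs']
  | [::], [::] => True
  | _, _ => False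
  end.

(** Greedy choice: a linking vertex has two forbidden values and the last vertex only one, so one
    vertex more than there are pairs suffices throughout. *)
Lemma avoids_exists zs w (R : seq T) : uniq R -> size zs < size R ->
  (if zs is z :: _ then w != z else true) ->
  exists ws, [/\ size ws = size zs, avoids w ws zs, uniq ws & {subset ws <= R}].
Proof.
elim: zs w R => [|z zs IH] w R uR szR wz; first by exists [::].
pose bad := if zs is z' :: _ then [:: z; z'] else [:: z].
have szb : size bad < size R by rewrite /bad; case: (zs) szR => [|z' l] /=; lia.
have [w' w'R w'b] : exists2 w', w' \in R & w' \notin bad.
  apply/hasP; rewrite -[has _ _]negbK -all_predC; apply/negP => /allP sub.
  have: size R <= size bad.
    by apply: uniq_leq_size => // y /sub /=; rewrite negbK.
  by rewrite leqNgt szb.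
have [||ws [h1 h2 h3 h4]] := IH w' (rem w' R) (rem_uniq w' uR).
- by rewrite size_rem // -ltnS prednK //; case: (R) w'R.
- by move: w'b; rewrite /bad; case: (zs) => [|z' ?] //; rewrite !inE negb_or => /andP[].
exists (w' :: ws); split=> //=; first by rewrite h1.
- split=> //; move: w'b; rewrite /bad.
  by case: (zs) => [|z' ?]; rewrite !inE ?negb_or // => /andP[].
- rewrite h3 andbT; apply/negP => /h4; by rewrite mem_rem_uniq // inE eqxx.
- by move=> y; rewrite inE => /orP[/eqP->//|/h4 /mem_rem].
Qed.

Lemma good_pairs_exist k x p W : walk c x p -> rigid c x p W -> uniq (x :: p ++ W) ->
  size p = 4 * k -> exists2 zs, size zs = k & pairs (good_pair W) x p zs.
Proof.
elim: k x p => [|k IH] x p wk rg un sz.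
  by case: p sz {wk rg un} => // _; exists [::].
case: p sz wk rg un => [|b1 [|a2 [|b2 [|a3 p]]]] sz wk rg un; rewrite /= in sz; try lia.
have [wk1 wk2] : walk c x [:: b1; a2; b2; a3] /\ walk c a3 p.
  by move: wk; rewrite (@walk_cat _ c x [:: b1; a2; b2; a3]) // => /andP[].
have [||z hz] := @good_pair_exists x b1 a2 b2 a3 W wk1.
- exact: (@rigid_block _ c x [::] [:: b1; a2; b2; a3] p).
- by move: un; apply: subseq_uniq; rewrite /= !eqxx; exact: suffix_subseq.
have [|||zs sz' hzs] := IH a3 p wk2.
- apply: (@rigid_block _ c x [:: b1; a2; b2; a3] p [::]) => //; by rewrite cats0.
- by move: un; rewrite -[x :: _]/([:: x; b1; a2; b2] ++ (a3 :: p ++ W)) cat_uniq => /and3P[].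
- lia.
by exists (z :: zs); rewrite /= ?sz'.
Qed.

Lemma avoids_size w ws zs : avoids w ws zs -> size ws = size zs.
Proof. by elim: zs w ws => [|z zs IH] w [|w' ws] //= [_ _ /IH ->]. Qed.

(** If [ws] is empty, both parts end at [w0] and are not disjoint in the sense of [lpath_join]; the
    second part then has to be trivial. *)
Lemma lpath_extend k1 k2 ws A A' B w w0 S W :
  lpath blue k1 w w0 S -> {subset w0 :: S <= A ++ A'} ->
  lpath blue k2 w0 (last w0 ws) (B ++ ws) -> (ws = [::] -> k2 = 0) ->
  uniq (A ++ B ++ W) -> {subset A' <= W} -> {subset ws <= W} -> uniq (A' ++ ws) ->
  lpath blue (k1 + k2) w (last w0 ws) (A ++ B ++ A' ++ ws).
Proof.
move=> l1 s1 l2 e un sA sw uw; case: ws => [|w1 ws] in l2 e sw uw *.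
  rewrite e // addn0; apply: lpath_sub l1 => y yS.
  by move: (s1 y); rewrite inE yS orbT !mem_cat => /(_ isT) /orP[] ->; rewrite ?orbT.
apply: lpath_join l1 l2 un s1 _ sA sw uw => y; rewrite inE => /orP[/eqP->|//].
by rewrite mem_cat /= mem_last orbT.
Qed.

(** Each left path may use the joint before its pair and spares the one after it, so neighbours
    never compete and the last joint of [p] stays free: hence [belast]. *)
Lemma left_chain zs x p w ws W : uniq (x :: p ++ W) ->
  pairs (left_pair W) x p zs -> avoids w ws zs -> uniq (w :: ws) ->
  {subset w :: ws <= W} ->
  lpath blue (size zs).*2 w (last w ws) (belast x p ++ ws).
Proof.
elim: zs x p w ws => [|z zs IH] x [|b1 [|a2 [|b2 [|a3 p]]]] w [|w1 ws] //= un.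
  by move=> *; exact: lpath0.
case=> hl hp [wz w1z av]; rewrite inE negb_or => /andP[/andP[ww1 wws] /andP[w1ws uws]] sub.
have [wW w1W] : w \in W /\ w1 \in W by split; apply: sub; rewrite !inE eqxx ?orbT.
have swW : {subset ws <= W} by move=> y yw; apply: sub; rewrite !inE yw !orbT.
have un3 : uniq ([:: x; b1; a2; b2] ++ (a3 :: p ++ W)) by [].
have un2 : uniq (a3 :: p ++ W) by move: un3; rewrite cat_uniq => /and3P[].
have rest := IH a3 p w1 ws un2 hp av _ _.
rewrite doubleS -(addn2 _.*2) addnC.
apply: (@lpath_extend 2 _ ws [:: x; b1; a2; b2] [:: w1] (belast a3 p) w w1 _ W
  (hl w w1 wW w1W ww1 wz w1z)) => //.
- by sub_lists.
- by apply: rest; rewrite /= ?w1ws // => y; rewrite inE => /orP[/eqP->//|/swW].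
- by move=> e; rewrite -(avoids_size av) e.
- by apply: subseq_uniq un3; rewrite cat_subseq // -cat_cons cat_subseq // lastI subseq_rcons.
- by move=> y; rewrite inE => /eqP->.
- by rewrite /= w1ws.
Qed.

(** Strong induction, because a step takes one pair or two; the invariant is that the first joint is
    free. A right path takes the joint of the next pair. This is harmless if there is no next pair
    or if that pair has an inner path; otherwise [two_pairs] serves both at once. *)
Lemma chain zs x p w ws W : walk c x p -> rigid c x p W -> uniq (x :: p ++ W) ->
  pairs (good_pair W) x p zs -> avoids w ws zs -> uniq (w :: ws) ->
  {subset w :: ws <= W} ->
  lpath blue (size zs).*2 w (last w ws) ((x :: p) ++ ws).
Proof.
have [n] := ubnP (size zs).
elim: n zs x p w ws => // n IH [|z zs] x [|b1 [|a2 [|b2 [|a3 p]]]] w [|w1 ws] //.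
  by move=> *; exact: lpath0.
rewrite [size (z :: zs)]/= ltnS => szn wk rg un [hz hp] [wz w1z av].
rewrite [uniq _]/= inE negb_or => /andP[/andP[ww1 wws] /andP[w1ws uws]] sub.
have [wW w1W] : w \in W /\ w1 \in W by split; apply: sub; rewrite !inE eqxx ?orbT.
have swW : {subset ws <= W} by move=> y yw; apply: sub; rewrite !inE yw !orbT.
have un3 : uniq ([:: x; b1; a2; b2] ++ (a3 :: p) ++ W) by [].
have un2 : uniq (a3 :: p ++ W) by move: un3; rewrite cat_uniq => /and3P[].
have [wk1 wk2] : walk c x [:: b1; a2; b2; a3] /\ walk c a3 p.
  by move: wk; rewrite (@walk_cat _ c x [:: b1; a2; b2; a3]) // => /andP[].
have rg2 : rigid c a3 p W.
  apply: (@rigid_block _ c x [:: b1; a2; b2; a3] p [::]) => //; by rewrite cats0.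
have first S : {subset S <= [:: x; b1; a2; b2]} -> lpath blue 2 w w1 S ->
    lpath blue (size (z :: zs)).*2 w (last w (w1 :: ws))
      ((x :: [:: b1, a2, b2, a3 & p]) ++ w1 :: ws).
  move=> sS l1; rewrite [size _]/= doubleS -(addn2 _.*2) addnC.
  apply: (@lpath_extend 2 _ ws [:: x; b1; a2; b2] [:: w1] (a3 :: p) w w1 _ W l1) => //.
  - by move=> y; rewrite inE => /orP[/eqP->|/sS]; rewrite mem_cat ?inE ?eqxx ?orbT // => ->.
  - apply: IH => //; first by rewrite /= w1ws.
    by move=> y; rewrite inE => /orP[/eqP->//|/swW].
  - by move=> e; rewrite -(avoids_size av) e.
  - by move=> y; rewrite inE => /eqP->.
  - by rewrite /= w1ws.
case: hz => [hI|[hN hlr]].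
  by apply: (first [:: b1; a2; b2]); [sub_lists|apply: hI].
have [|nl] := classic (lpath blue 2 w w1 [:: x; b1; a2; b2]); first exact: first.
have {hlr}rt : lpath blue 2 w w1 [:: b1; a2; b2; a3].
  by case: (hlr w w1 wW w1W ww1 wz w1z).
case: zs ws p => [|z2 zs] [|w2 ws] [|b3 [|a4 [|b4 [|a5 p]]]] // in hp av wws w1ws uws sub swW
  un un2 un3 wk wk2 rg rg2 szn first *.
  by apply: lpath_sub rt; sub_lists.
case: hp => [hz2 hp]; case: av => [w1z2 w2z2 av].
move: wws w1ws uws; rewrite !inE !negb_or => /andP[ww2 wws] /andP[w1w2 w1ws] /andP[w2ws uws].
have w2W : w2 \in W by apply: swW; rewrite mem_head.
have sW : {subset ws <= W} by move=> y yw; apply: swW; rewrite inE yw orbT.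
have un4 : uniq ([:: x; b1; a2; b2; a3; b3; a4; b4] ++ (a5 :: p) ++ W) by [].
have un5 : uniq (a5 :: p ++ W) by move: un4; rewrite cat_uniq => /and3P[].
have [wk3 wk4] : walk c a3 [:: b3; a4; b4; a5] /\ walk c a5 p.
  by move: wk2; rewrite (@walk_cat _ c a3 [:: b3; a4; b4; a5]) // => /andP[].
have rg4 : rigid c a5 p W.
  apply: (@rigid_block _ c a3 [:: b3; a4; b4; a5] p [::]) => //; by rewrite cats0.
(* Both pairs are traversed without [a5], so the invariant holds for the rest. *)
have front : lpath blue 4 w w2 [:: b1; a2; b2; a3; b3; a4; b4; w1].
  have uw3 : uniq ([:: x; b1; a2; b2; a3; b3; a4; b4; a5] ++ [:: w; w1; w2]).
    apply: (@uniq_cat_sub _ W).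
    - apply: subseq_uniq un4.
      rewrite -[X in subseq _ X]/([:: x; b1; a2; b2; a3; b3; a4; b4; a5] ++ (p ++ W)).
      by rewrite cat_subseq // suffix_subseq.
    - by rewrite /= !inE negb_or ww1 ww2 w1w2.
    - by move=> y; rewrite !inE => /or3P[] /eqP->.
  have inner : lpath blue 2 w1 w2 [:: b3; a4; b4] ->
      lpath blue 4 w w2 [:: b1; a2; b2; a3; b3; a4; b4; w1].
    move=> l2; have un6 : uniq ([:: b1; a2; b2; a3] ++ [:: b3; a4; b4] ++ [:: w; w1; w2]).
      apply: subseq_uniq uw3; rewrite -[X in subseq _ X]/([:: x] ++ [:: b1; a2; b2; a3] ++
        [:: b3; a4; b4] ++ [:: a5] ++ [:: w; w1; w2]).
      apply: subseq_trans (suffix_subseq _ _).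
      by do 2! [rewrite cat_subseq //]; exact: suffix_subseq.
    apply: lpath_sub_end (lpath_join (A' := [:: w1]) (B' := [:: w2]) rt l2 un6 _ _ _ _ _);
      try by sub_lists.
    by rewrite /= !inE w1w2.
  case: hz2 => [hI|[hM _]]; first by apply/inner/hI.
  have sub3 : {subset [:: w; w1; w2] <= W} by move=> y; rewrite !inE => /or3P[] /eqP->.
  have [] := @two_pairs _ c hc x b1 a2 b2 a3 b3 a4 b4 a5 w w1 w2 _ _ uw3.
  - by move: wk; rewrite (@walk_cat _ c x [:: b1; a2; b2; a3; b3; a4; b4; a5]) // => /andP[].
  - apply: rigid_sub sub3 _.
    exact: (@rigid_block _ c x [::] [:: b1; a2; b2; a3; b3; a4; b4; a5] p).
  - by move=> y /sub3 /hN.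
  - by move=> y /sub3 /hM.
  - by [].
  - exact: inner.
  - by [].
rewrite [size _]/= !doubleS -(addn4 _.*2) addnC.
apply: (@lpath_extend 4 _ ws [:: x; b1; a2; b2; a3; b3; a4; b4] [:: w1; w2] (a5 :: p)
  w w2 _ W front) => //.
- by sub_lists.
- apply: (IH zs a5 p w2 ws (ltnW szn)) => //; by rewrite /= w2ws.
- by move=> e; rewrite -(avoids_size av) e.
- by move=> y; rewrite !inE => /orP[] /eqP->.
- by rewrite /= !inE negb_or w1w2 w1ws w2ws.
Qed.
End Chains.

(** * From a red cycle to a longer red cycle or a blue cycle *)

Section KeyStep.
Variables (T : eqType) (c : T -> T -> T -> bool) (V : seq T).
Hypotheses (hc : sym3 c) (uV : uniq V).
Implicit Types (x y z u v w : T) (p q s W ws zs : seq T).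

Notation blue := (neg3 c).

Ltac sub_lists := let y := fresh "y" in
  rewrite ?(inE, mem_cat); do ?[case/orP]; by move=> ->; rewrite ?orbT.

Lemma gap_closing d x p u v sp : (d == 1) || (d == 2) -> size p = d.*2 -> size sp = d ->
  walk c x p -> rigid c x p (u :: v :: sp) -> uniq (x :: p ++ u :: v :: sp) ->
  lpath blue d.+1 u v ((x :: p) ++ sp).
Proof.
case/orP=> /eqP->.
  by case: p sp => [|b [|a [|? ?]]] [|y [|? ?]] // _ _; exact: spare_edge.
by case: p sp => [|b1 [|a2 [|b2 [|a3 [|? ?]]]]] [|y [|y' [|? ?]]] // _ _; exact: spare_pair.
Qed.

(** A block of d + 2 edges yields d + 3 blue ones; the missing left path is what gains the edge. *)
Lemma bad_closing d x b1 a2 b2 a3 q a u v sp w : (d == 1) || (d == 2) ->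
  let p := [:: b1, a2, b2, a3 & q ++ [:: a]] in
  size q = (d.*2).-1 -> size sp = d -> walk c x p ->
  rigid c x p (u :: v :: sp ++ [:: w]) -> uniq (p ++ u :: v :: sp ++ [:: w]) ->
  uniq [:: v; x; b1; a2; b2] -> blue_ends c x b1 b2 a3 (u :: v :: sp ++ [:: w]) ->
  ~ lpath blue 2 u v [:: x; b1; a2; b2] ->
  lpath blue d.+3 w u ([:: b1, a2, b2, a3 & q] ++ v :: sp).
Proof.
case/orP=> /eqP-> /=.
  case: q sp => [|b3 [|? ?]] [|y [|? ?]] //= _ _ wk rg un un2 hN nl.
  by case: (left_or_even hc wk rg un un2 hN).
case: q sp => [|b3 [|a4 [|b4 [|? ?]]]] [|y [|y' [|? ?]]] //= _ _ wk rg un un2 hN nl.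
by case: (left_or_odd hc wk rg un un2 hN).
Qed.

Lemma bad_closing_closed d x b1 a2 b2 a3 q a u v sp : (d == 1) || (d == 2) ->
  let p := [:: b1, a2, b2, a3 & q ++ [:: a]] in
  size q = (d.*2).-1 -> size sp = d -> walk c x p ->
  rigid c x p (u :: v :: sp) -> uniq (p ++ u :: v :: sp) ->
  uniq [:: v; x; b1; a2; b2] -> blue_ends c x b1 b2 a3 (u :: v :: sp) ->
  ~ lpath blue 2 u v [:: x; b1; a2; b2] ->
  lpath blue d.+3 u u ([:: b1, a2, b2, a3 & q] ++ v :: sp).
Proof.
case/orP=> /eqP-> /=.
  case: q sp => [|b3 [|? ?]] [|y [|? ?]] //= _ _ wk rg un un2 hN nl.
  by case: (left_or_even_closed hc wk rg un un2 hN).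
case: q sp => [|b3 [|a4 [|b4 [|? ?]]]] [|y [|y' [|? ?]]] //= _ _ wk rg un un2 hN nl.
by case: (left_or_odd_closed hc wk rg un un2 hN).
Qed.

Definition outside s := [seq v <- V | v \notin s].

Lemma size_outside s : uniq s -> {subset s <= V} -> size (outside s) = size V - size s.
Proof.
move=> us sV; have <-: count (mem s) V = size s.
  rewrite -size_filter; apply/perm_size/uniq_perm; rewrite ?filter_uniq // => y.
  by rewrite mem_filter /=; case ys: (y \in s) => //=; exact: sV.
by rewrite -(count_predC (mem s) V) addKn size_filter.
Qed.

Lemma eq_outside s s' : s =i s' -> outside s = outside s'.
Proof. by move=> e; apply: eq_filter => y; rewrite e. Qed.

Lemma uniq_outside s : uniq s -> uniq (s ++ outside s).
Proof.
move=> us; rewrite cat_uniq us filter_uniq // andbT /=.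
by apply/hasPn => y; rewrite mem_filter => /andP[].
Qed.

Lemma outside_sub s : {subset outside s <= V}.
Proof. by move=> y; rewrite mem_filter => /andP[]. Qed.

Definition is_cycle k x s :=
  [/\ walk c x s, last x s = x, size s = k.*2, uniq s & {subset s <= V}].

Lemma cycle_rot k x s1 s2 : ~~ odd (size s1) -> is_cycle k x (s1 ++ s2) ->
  is_cycle k (last x s1) (s2 ++ s1).
Proof.
move=> ev [h1 h2 h3 h4 h5]; split.
- exact: walk_rot.
- by move: h2; rewrite !last_cat => ->.
- by rewrite size_cat addnC -size_cat.
- by rewrite uniq_catC.
- by move=> y; rewrite mem_cat orbC -mem_cat; exact: h5.
Qed.

(** The walk returns to [x], so [x] is the last vertex of [r] and lies off [p]. *)
Lemma cycle_block_uniq k x p r : is_cycle k x (p ++ r) -> 0 < size r ->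
  uniq (x :: p ++ outside (p ++ r)).
Proof.
move=> [_ lx _ us _] r0; have un := uniq_outside us.
have xr : x \in r.
  by rewrite -{1}lx last_cat; case: (r) r0 => // y r' _; rewrite [last _ _]/= mem_last.
have un2 : uniq (p ++ outside (p ++ r)).
  by apply: subseq_uniq un; rewrite -catA cat_subseq // suffix_subseq.
rewrite cons_uniq un2 andbT mem_cat negb_or mem_filter mem_cat xr orbT andbT.
by move: us; rewrite cat_uniq => /and3P[_ /hasPn /(_ x xr)].
Qed.

Lemma leq_size_notin (W s : seq T) : uniq W ->
  size W - size s <= size [seq y <- W | y \notin s].
Proof.
move=> uW; rewrite leq_subLR size_filter -[leqLHS](count_predC (mem s)) leq_add2r.
rewrite -size_filter; apply: uniq_leq_size; rewrite ?filter_uniq // => y.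
by rewrite mem_filter => /andP[].
Qed.

(** The closing block has d + 2 edges and is followed by t pairs. The outside vertices are [u], [v],
    the t vertices of the chain and d spare ones. The closing path avoids [x] and [a], so the chain
    may use all of [a :: p], whose last joint is [x] when the cycle is used up. *)
Lemma bad_case d t k x b1 a2 b2 a3 q a r u v : (d == 1) || (d == 2) ->
  let s := [:: b1, a2, b2, a3 & q ++ a :: r] in let W := outside s in
  size q = (d.*2).-1 -> is_cycle k x s -> ~ cyc c V k.+1 -> 4 * t <= size r ->
  t + d.+2 <= size W -> u \in W -> v \in W -> u != v -> blue_ends c x b1 b2 a3 W ->
  ~ lpath blue 2 u v [:: x; b1; a2; b2] -> cyc blue V (t.*2 + d.+3).
Proof.
move=> hd s W szq cy no szr szW uW vW uv hN nl.
have [wk lx szs us sV] := cy.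
have rg : rigid c x s W := cyc_rigid wk lx szs us sV no.
have un : uniq (s ++ W) := uniq_outside us.
pose G := [:: b1, a2, b2, a3 & q]; pose P := [:: b1, a2, b2, a3 & q ++ [:: a]].
pose p := take (4 * t) r; pose D := drop (4 * t) r.
have szp : size p = 4 * t by rewrite size_takel.
have sG : s = G ++ (a :: p) ++ D by rewrite /s /G /p /D /= cat_take_drop.
have sP : s = P ++ p ++ D by rewrite /s /P /p /D /= -catA cat_take_drop.
have evP : ~~ odd (size P) by rewrite /P /= size_cat szq; case/orP: hd => /eqP->.
have evp : ~~ odd (size p) by rewrite szp oddM.
have lP : last x P = a by rewrite /P /= last_cat.
have [wkP wkp] : walk c x P /\ walk c a p.
  by move: wk; rewrite sP walk_cat // lP walk_cat // => /and3P[].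
have rgP : rigid c x P W by apply: (@rigid_block _ c x [::] P (p ++ D)); rewrite -?sP.
have rgp : rigid c a p W by rewrite -lP; apply: (@rigid_block _ c x P p D); rewrite -?sP.
have unP : uniq (P ++ W).
  by apply: subseq_uniq un; rewrite sP -catA cat_subseq // suffix_subseq.
have unp : uniq (a :: p ++ W).
  rewrite -cat_cons; apply: subseq_uniq un; rewrite sG -catA.
  by apply: subseq_trans (suffix_subseq _ _); rewrite -catA cat_subseq // suffix_subseq.
have unx : uniq (x :: [:: b1; a2; b2; a3] ++ W).
  by apply: (@cycle_block_uniq k x [:: b1; a2; b2; a3] (q ++ a :: r)) => //; rewrite size_cat addnS.
have uWW : uniq W by rewrite filter_uniq.
have Ws y : y \in W -> y \notin s by rewrite mem_filter => /andP[].
have [zs szz hzs] := good_pairs_exist hc wkp rgp unp szp.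
have main : forall u v, u \in W -> v \in W -> u != v ->
    ~ lpath blue 2 u v [:: x; b1; a2; b2] ->
    (if zs is z :: _ then u != z else true) -> cyc blue V (t.*2 + d.+3).
  move=> {u v uW vW uv nl} u v uW vW uv nl uz; pose R := rem v (rem u W).
  have uR : uniq R by rewrite !rem_uniq.
  have memR y : (y \in R) = [&& y != v, y != u & y \in W].
    by rewrite /R mem_rem_uniq ?rem_uniq // inE mem_rem_uniq // inE.
  have szR : size R = (size W).-2.
    by rewrite /R !size_rem ?mem_rem_uniq // inE eq_sym uv.
  have [|ws [szws av uws wsR]] := @avoids_exists _ zs u R uR _ uz.
    by rewrite szR szz; move: hd szW; clear; move: (size W) => N; case/orP=> /eqP ->; lia.
  pose sp := take d [seq y <- R | y \notin ws].
  have szsp : size sp = d.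
    rewrite size_takel //; apply: leq_trans (leq_size_notin ws uR).
    by rewrite szR szws szz; move: szW; clear; move: (size W) => N; lia.
  have spR y : y \in sp -> (y \in R) && (y \notin ws).
    by move/mem_take; rewrite mem_filter andbC.
  have usp : uniq sp by rewrite take_uniq // filter_uniq.
  have ux2 : uniq [:: v; x; b1; a2; b2].
    apply: (@subseq_uniq _ _ ([:: v] ++ [:: x; b1; a2; b2] ++ [:: a3])).
      by rewrite catA prefix_subseq.
    rewrite uniq_catC; apply: (@uniq_cat_sub _ [:: x; b1; a2; b2; a3] W) => // y.
    by rewrite inE => /eqP->.
  have usp3 : uniq (u :: v :: sp).
    rewrite /= inE negb_or uv usp andbT; apply/andP; split; apply/negP => /spR;
    by rewrite memR eqxx ?andbF.
  have sub1 : {subset u :: v :: sp <= W}.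
    by move=> y; rewrite !inE => /or3P[/eqP->|/eqP->|/spR] //; rewrite memR => /andP[/and3P[]].
  (* An empty [ws] means t = 0: there is no chain, and the closing path itself returns to [u]. *)
  have [ws0|[w wws lws]] : ws = [::] \/ exists2 w, w \in ws & last u ws = w.
    case: (ws) => [|w ws']; first by left.
    by right; exists (last u (w :: ws')); rewrite //= mem_last.
    have t0 : t = 0 by rewrite -szz -szws ws0.
    have l := @bad_closing_closed d x b1 a2 b2 a3 q a u v sp hd szq szsp wkP
      (rigid_sub sub1 rgP) (uniq_cat_sub unP usp3 sub1) ux2 _ nl.
    rewrite t0; apply: cyc_lpath (l _) => y; last by move/sub1/hN.
    rewrite inE => /orP[/eqP->|]; first exact: outside_sub uW.
    rewrite mem_cat => /orP[yG|ysp]; last first.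
      by apply/outside_sub/sub1; rewrite inE ysp orbT.
    by apply: sV; rewrite sG mem_cat yG.
  have wR := wsR _ wws; move: (wR); rewrite memR => /and3P[wv wu wW].
  have sub2 : {subset u :: v :: sp ++ [:: w] <= W}.
    move=> y; rewrite -!cat_cons mem_cat => /orP[/sub1//|].
    by rewrite inE => /eqP->.
  have usp4 : uniq (u :: v :: sp ++ [:: w]).
    rewrite -!cat_cons cat_uniq usp3 /= orbF andbT.
    rewrite !inE !negb_or wu wv /=; by apply/negP => /spR; rewrite wws andbF.
  have l := @bad_closing d x b1 a2 b2 a3 q a u v sp w hd szq szsp wkP
      (rigid_sub sub2 rgP) (uniq_cat_sub unP usp4 sub2) ux2 _ nl.
  have ch : lpath blue (size zs).*2 u (last u ws) ((a :: p) ++ ws).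
    apply: (chain hc wkp rgp unp hzs av) => [|y].
      by rewrite /= uws andbT; apply/negP => /wsR; rewrite memR eqxx andbF.
    by rewrite inE => /orP[/eqP->//|/wsR]; rewrite memR => /and3P[].
  rewrite lws szz in ch.
  have wsW y : y \in ws -> y \in W by move/wsR; rewrite memR => /and3P[].
  apply: cyc_lpath (lpath_cat ch (l _) _) => [y|y|y].
  - have sV' z : (z \in G) || (z \in a :: p) -> z \in V.
      by move=> h; apply: sV; rewrite sG !mem_cat orbA h.
    rewrite inE => /orP[/eqP->|]; first exact: outside_sub uW.
    rewrite inE => /orP[/eqP->|]; first exact: outside_sub wW.
    rewrite !mem_cat => /orP[/orP[yp|/wsW yw]|/orP[yG|ysp]].
    + by apply: sV'; rewrite yp orbT.
    + exact: outside_sub yw.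
    + by apply: sV'; rewrite yG.
    + by apply/outside_sub/sub1; rewrite inE ysp orbT.
  - by move/sub2/hN.
  have inws : y \in w :: (a :: p) ++ ws -> (y \in a :: p) || (y \in ws).
    by rewrite inE mem_cat => /orP[/eqP->|//]; rewrite wws orbT.
  move/inws => h1; rewrite inE mem_cat => h2.
  have: (y \in G) || (y \in u :: v :: sp).
    by move: h2; rewrite [_ \in u :: _]inE; case/or3P=> -> //; rewrite !orbT.
  move=> {h2} /orP[yG|y2].
    case/orP: h1 => [yp|/wsW/Ws]; last by rewrite sG mem_cat yG.
    by move: us; rewrite sG cat_uniq => /and3P[_ /hasPn /(_ y)]; rewrite mem_cat yp yG => /(_ isT).
  case/orP: h1 => [yp|yw].
    by move: (Ws _ (sub1 _ y2)); rewrite sG !mem_cat yp !orbT.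
  move: y2; rewrite !inE; move: (wsR _ yw); rewrite memR => /and3P[/negbTE -> /negbTE -> _] /=.
  by move/spR; rewrite yw andbF.
(* The chain starts at [u]. If [u] is the exceptional vertex of its first pair, then [v] is not, and
   the lack of a left path is symmetric in [u] and [v]. *)
have [h|h] := boolP (if zs is z :: _ then u != z else true); first exact: main nl h.
apply: (main v u) => //; first by rewrite eq_sym.
- have notin y : y \in W -> y \notin [:: x; b1; a2; b2].
    move=> yW; move: unx; rewrite -cat_cons cat_uniq => /and3P[_ /hasPn /(_ y yW) xy _].
    by apply: contra xy; sub_lists.
  move=> l; apply: nl; apply: lpath2_sym l; rewrite ?notin // 1?eq_sym //.
  exact: sym3_neg.
- by case: (zs) h => // z zs' /negPn /eqP <-; rewrite eq_sym.
Qed.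

Lemma cycle_inner_or_ends k x b1 a2 b2 a3 r :
  let s := [:: b1, a2, b2, a3 & r] in is_cycle k x s -> ~ cyc c V k.+1 ->
  (exists z, inner_pair c b1 a2 b2 (outside s) z) \/ blue_ends c x b1 b2 a3 (outside s).
Proof.
move=> s [wk lx szs us sV] no.
have rg : rigid c x s (outside s) := cyc_rigid wk lx szs us sV no.
have un := uniq_outside us.
apply: (inner_or_blue_ends hc) => //.
- by move: wk; rewrite (@walk_cat _ c x [:: b1; a2; b2; a3] r) // => /andP[].
- exact: (@rigid_block _ c x [::] [:: b1; a2; b2; a3] r).
- apply: subseq_uniq un; rewrite -[s]/([:: b1; a2; b2; a3] ++ r) -catA.
  by rewrite cat_subseq // suffix_subseq.
Qed.

(* If three consecutive pairs are all not inner, both middle vertices of the two middle edges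
   are blue towards their common joint, which makes the middle pair inner. *)
Lemma inner_cycle_exists k x s : 3 <= k -> is_cycle k x s -> ~ cyc c V k.+1 ->
  exists x b1 a2 b2 a3 r z, is_cycle k x [:: b1, a2, b2, a3 & r] /\
    inner_pair c b1 a2 b2 (outside [:: b1, a2, b2, a3 & r]) z.
Proof.
move=> k3 cy no; have szs : 6 <= size s by case: cy => _ _ -> _ _; lia.
case: s szs cy => [|b1 [|a2 [|b2 [|a3 [|b3 [|a4 r]]]]]] // _ cy1.
have cy2 : is_cycle k a2 [:: b2, a3, b3, a4 & r ++ [:: b1; a2]].
  exact: (@cycle_rot k x [:: b1; a2] [:: b2, a3, b3, a4 & r]).
have cy3 : is_cycle k a3 ([:: b3, a4 & r ++ [:: b1; a2]] ++ [:: b2; a3]).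
  exact: (@cycle_rot k a2 [:: b2; a3] [:: b3, a4 & r ++ [:: b1; a2]]).
have [[z hz]|N1] := cycle_inner_or_ends cy1 no.
  by do 7 eexists; split; [exact: cy1|exact: hz].
have [[z hz]|N2] := cycle_inner_or_ends cy2 no.
  by do 7 eexists; split; [exact: cy2|exact: hz].
(* For k = 3 the third pair wraps around to [b1] and [a2]. *)
have [b4 [a5 [r' er]]] : exists b4 a5 r', (r ++ [:: b1; a2]) ++ [:: b2; a3] = [:: b4, a5 & r'].
  by case: (r) => [|? [|? ?]]; do 3 eexists.
rewrite /= er in cy3.
have [[z hz]|N3] := cycle_inner_or_ends cy3 no.
  by do 7 eexists; split; [exact: cy3|exact: hz].
have e12 : outside [:: b2, a3, b3, a4 & r ++ [:: b1; a2]] = outside [:: b1, a2, b2, a3, b3, a4 & r].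
  apply: eq_outside => y; rewrite -[[:: b2, a3, b3, a4 & _]]/([:: b2, a3, b3, a4 & r] ++ _).
  by rewrite mem_cat orbC -mem_cat.
have e32 : outside [:: b2, a3, b3, a4 & r ++ [:: b1; a2]] = outside [:: b3, a4, b4, a5 & r'].
  rewrite -[RHS]/(outside ([:: b3; a4] ++ [:: b4, a5 & r'])) -er; apply: eq_outside => y.
  rewrite -[[:: b2, a3, b3, a4 & _]]/([:: b2; a3] ++ [:: b3, a4 & r ++ [:: b1; a2]]).
  by rewrite mem_cat orbC -mem_cat.
have [_ _ _ us2 _] := cy2; have un2 := uniq_outside us2.
do 7 eexists; split; first exact: cy2.
move=> u v uW vW uv _ _; exists [:: b2; a3; b3; v]; split=> //.
- have [h1 h2] := hc; rewrite /= /neg3 andbT; apply/andP; split.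
    by rewrite h1 h2; case: (N1 u); rewrite -?e12.
  by case: (N3 v); rewrite -?e32.
- apply: (@subseq_uniq _ _ ([:: b2; a3; b3] ++ [:: v])) => //.
  apply: (uniq_cat_sub (W := outside [:: b2, a3, b3, a4 & r ++ [:: b1; a2]])) => //.
    apply: subseq_uniq un2.
    apply: (@cat_subseq _ [:: b2; a3; b3] _ [:: b2; a3; b3] ((a4 :: r ++ [:: b1; a2]) ++ _)) => //.
    exact: suffix_subseq.
  by move=> y; rewrite inE => /eqP->.
- by move=> y; rewrite !inE => /or4P[] ->; rewrite ?orbT.
(* The middle pair has inner paths for all outside vertices, so its exceptional vertex is
   arbitrary. *)
Unshelve. all: exact: x.
Qed.

Definition no_bad_pair k := forall x b1 a2 b2 a3 r u v,
  let s := [:: b1, a2, b2, a3 & r] in is_cycle k x s ->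
  blue_ends c x b1 b2 a3 (outside s) -> u \in outside s -> v \in outside s -> u != v ->
  lpath blue 2 u v [:: x; b1; a2; b2].

(** The predicate [Z] carries information on the exceptional vertices: none in the key step, and
    that they lie on the cycle when there is no red path. *)
Lemma left_pairs_exist (Z : pred T) t k x s1 p s2 :
  (forall x b1 a2 b2 a3 r, let s := [:: b1, a2, b2, a3 & r] in is_cycle k x s ->
     exists2 z, Z z & left_pair c (outside s) x b1 a2 b2 a3 z) ->
  is_cycle k x (s1 ++ p ++ s2) -> ~~ odd (size s1) -> size p = 4 * t ->
  exists zs, [/\ size zs = t, all Z zs &
    pairs (left_pair c (outside (s1 ++ p ++ s2))) (last x s1) p zs].
Proof.
move=> H; elim: t s1 p => [|t IH] s1 p cy ev szp.
  by case: p szp cy => // _ cy; exists [::].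
case: p szp cy => [|b1 [|a2 [|b2 [|a3 p]]]] szp cy; rewrite /= in szp; try lia.
have cy' : is_cycle k (last x s1) [:: b1, a2, b2, a3 & (p ++ s2) ++ s1].
  exact: (@cycle_rot k x s1 ([:: b1, a2, b2, a3 & p] ++ s2)).
have eW : outside (s1 ++ [:: b1, a2, b2, a3 & p] ++ s2) =
    outside [:: b1, a2, b2, a3 & (p ++ s2) ++ s1].
  by apply: eq_outside => y; rewrite mem_cat orbC -mem_cat.
have [z Zz hz] := H _ _ _ _ _ _ cy'; rewrite -eW in hz.
have [|||zs [szz hZ hzs]] := IH (s1 ++ [:: b1; a2; b2; a3]) p.
- by rewrite -catA.
- by rewrite size_cat oddD (negbTE ev).
- by lia.
exists (z :: zs); rewrite /= ?szz Zz //; split=> //; split=> //.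
by move: hzs; rewrite last_cat -catA.
Qed.

(** The inner path on the first pair spares [x] and [a3], and the left paths on the next t pairs
    spare the joint [be]. The gap of d edges after [be] thus has both end joints free, even if it
    ends at [x]. It gives d + 1 blue edges, and 2 + 2t + (d + 1) is the required length. *)
Lemma no_bad_case d t k : (d == 1) || (d == 2) -> no_bad_pair k -> ~ cyc c V k.+1 ->
  cyc c V k -> t.*2 + d.+2 <= k -> t + d.+2 <= size V - k.*2 ->
  cyc blue V (t.*2 + d.+3).
Proof.
move=> hd nb no [x0 [s0 cy0]] szk szV.
have k3 : 3 <= k by move: hd szk; clear; case/orP=> /eqP->; lia.
have [x [b1 [a2 [b2 [a3 [r [z [cy hz]]]]]]]] := inner_cycle_exists k3 cy0 no.
set s := [:: b1, a2, b2, a3 & r] in cy hz; set W := outside s in hz.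
have [wk lx szs us sV] := cy.
have rg : rigid c x s W := cyc_rigid wk lx szs us sV no.
have un : uniq (s ++ W) := uniq_outside us.
have szW : t + d.+2 <= size W by rewrite size_outside // szs.
pose p := take (4 * t) r; pose r1 := drop (4 * t) r.
pose G := take d.*2 r1; pose D := drop d.*2 r1.
have szr : 4 * t + d.*2 <= size r.
  by move: szs szk; rewrite /s /=; clear; move: (size r) => N; lia.
have szp : size p = 4 * t.
  by rewrite size_takel //; apply: leq_trans szr; exact: leq_addr.
have szG : size G = d.*2.
  by rewrite size_takel // size_drop; move: szr; clear; move: (size r) => N; lia.
have er : r = p ++ G ++ D by rewrite !cat_take_drop.
pose be := last a3 p.
pose A := [:: b1; a2; b2]; pose B := belast a3 p.
have eB : a3 :: p = B ++ [:: be] by rewrite lastI cats1.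
have sE : s = A ++ B ++ be :: G ++ D.
  by rewrite -[be :: _]/([:: be] ++ G ++ D) (catA B [:: be]) -eB /s er.
have evp : ~~ odd (size p) by rewrite szp oddM.
have eP : s = [:: b1; a2; b2; a3] ++ p ++ G ++ D by rewrite /s er.
have [wkp wkG] : walk c a3 p /\ walk c be G.
  move: wk; rewrite eP walk_cat // walk_cat // walk_cat ?szG ?odd_double //.
  by case/and4P.
have rgG : rigid c be G W.
  have -> : be = last x ([:: b1; a2; b2; a3] ++ p) by rewrite last_cat.
  apply: (@rigid_block _ c x _ G D).
    by rewrite size_cat oddD negb_add (negbTE evp).
  by rewrite -catA -eP.
have unG : uniq (be :: G ++ W).
  apply: subseq_uniq un; rewrite sE -!catA; apply: subseq_trans (suffix_subseq _ _).
  apply: subseq_trans (suffix_subseq _ _); rewrite -!cat_cons -!catA cat_subseq //.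
  exact: suffix_subseq.
have unAB : uniq (A ++ B ++ W).
  apply: subseq_uniq un; rewrite sE -!catA !cat_subseq //.
  exact: (suffix_subseq (be :: G ++ D) W).
have unp : uniq (a3 :: p ++ W).
  apply: subseq_uniq un; rewrite eP -cat_cons -[_ ++ p ++ _]/(A ++ (a3 :: p) ++ G ++ D).
  rewrite -!catA; apply: subseq_trans (suffix_subseq _ _); rewrite cat_subseq //.
  by rewrite catA suffix_subseq.
have [zs szz hzs] : exists2 zs, size zs = t & pairs (left_pair c W) a3 p zs.
  have := @left_pairs_exist predT t k x [:: b1; a2; b2; a3] p (G ++ D).
  rewrite -eP => /(_ _ cy isT szp); case=> [|zs [h1 _ h2]]; last by exists zs.
  move=> x1 b a b' a' r' s' cy'.
  have [[z' hz']|hN] := cycle_inner_or_ends cy' no; last first.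
    by exists x => // u v uW vW uv _ _; exact: (nb _ _ _ _ _ _ u v cy' hN).
  exists z' => // u v uW vW uv uz vz; apply: lpath_sub (hz' u v uW vW uv uz vz).
  by move=> y yin; rewrite inE yin orbT.
have uWW : uniq W by rewrite filter_uniq.
have Ws y : y \in W -> y \notin s by rewrite mem_filter => /andP[].
have [w0 w0W w0z] : exists2 w0, w0 \in W & w0 != z.
  apply/hasP; rewrite -[has _ _]negbK -all_predC; apply/negP => /allP sub.
  have: size W <= size [:: z].
    by apply: uniq_leq_size => // y /sub /=; rewrite negbK inE.
  by move: szW; clear; move: (size W) => N; rewrite /=; lia.
pose R := rem w0 W.
have uR : uniq R by rewrite rem_uniq.
have memR y : (y \in R) = (y != w0) && (y \in W) by rewrite mem_rem_uniq // inE.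
have szR : size R = (size W).-1 by rewrite size_rem.
(* The inner pair is put in front, so that its end [w1] also avoids the exceptional vertex of the
   first left pair. *)
have [|ws [szws av uws wsR]] := @avoids_exists _ (z :: zs) w0 R uR _ w0z.
  by rewrite szR /= szz; move: hd szW; clear; move: (size W) => N; case/orP=> /eqP->; lia.
case: ws szws av uws wsR => [|w1 ws] //= szws [_ w1z av] /andP[w1ws uws] wsR.
have wsW y : y \in w1 :: ws -> y \in W by move/wsR; rewrite memR => /andP[].
have w0ws : w0 \notin w1 :: ws by apply/negP => /wsR; rewrite memR eqxx.
have w1W : w1 \in W by apply: wsW; rewrite mem_head.
pose wl := last w1 ws.
have wlws : wl \in w1 :: ws by exact: mem_last.
pose sp := take d [seq y <- R | y \notin w1 :: ws].
have szsp : size sp = d.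
  rewrite size_takel //; apply: leq_trans (leq_size_notin (w1 :: ws) uR).
  by rewrite szR [size (_ :: _)]/= szws szz; move: szW; clear; move: (size W) => N; lia.
have spR y : y \in sp -> (y \in R) && (y \notin w1 :: ws).
  by move/mem_take; rewrite mem_filter andbC.
have usp : uniq sp by rewrite take_uniq // filter_uniq.
have ch : lpath blue (2 + t.*2) w0 wl (A ++ B ++ [:: w1] ++ ws).
  have l1 : lpath blue 2 w0 w1 A.
    by apply: hz => //; apply: contraNneq w0ws => ->; rewrite mem_head.
  apply: (lpath_extend l1 _ _ _ unAB) => //.
  - by move=> y; rewrite in_cons mem_cat mem_seq1 orbC.
  - rewrite -szz; apply: (left_chain unp hzs av); first by rewrite /= w1ws.
    exact: wsW.
  - by move=> e; rewrite -szz -(avoids_size av) e.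
  - by move=> y; rewrite inE => /eqP->.
  - by move=> y yw; apply: wsW; rewrite inE yw orbT.
  - by rewrite /= w1ws.
have usp2 : uniq (wl :: w0 :: sp).
  rewrite /= inE negb_or usp andbT -andbA; apply/and3P; split.
  - by apply: contraNneq w0ws => <-.
  - by apply/negP => /spR; rewrite wlws andbF.
  - by apply/negP => /spR; rewrite memR eqxx.
have sub2 : {subset wl :: w0 :: sp <= W}.
  move=> y; rewrite !inE => /or3P[/eqP->|/eqP->|/spR] //; first exact: wsW.
  by rewrite memR => /andP[/andP[]].
have l2 : lpath blue d.+1 wl w0 ((be :: G) ++ sp).
  apply: (gap_closing hd szG szsp wkG (rigid_sub sub2 rgG)).
  exact: (@uniq_cat_sub _ (be :: G) W).
have -> : t.*2 + d.+3 = 2 + t.*2 + d.+1 by clear; lia.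
apply: cyc_lpath (lpath_cat ch l2 _) => y.
  have sV' (y' : T) : (y' \in A ++ B) || (y' \in be :: G) -> y' \in V.
    move=> h; apply: sV; rewrite sE catA -cat_cons !mem_cat in h *.
    by case/orP: h => ->; rewrite ?orbT.
  rewrite inE => /orP[/eqP->|]; first exact: outside_sub w0W.
  rewrite inE => /orP[/eqP->|]; first exact: outside_sub (wsW _ wlws).
  rewrite mem_cat => /orP[]; last first.
    rewrite mem_cat => /orP[yG|ysp]; first by apply: sV'; rewrite yG orbT.
    by apply/outside_sub/sub2; rewrite !inE ysp !orbT.
  rewrite catA mem_cat => /orP[yAB|/wsW /outside_sub //].
  by apply: sV'; rewrite yAB.
have split1 : y \in wl :: A ++ B ++ [:: w1] ++ ws -> (y \in A ++ B) || (y \in w1 :: ws).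
  rewrite inE => /orP[/eqP->|]; first by rewrite wlws orbT.
  by rewrite catA mem_cat.
have split2 : y \in w0 :: (be :: G) ++ sp -> (y \in be :: G) || (y \in w0 :: sp).
  by rewrite in_cons mem_cat [_ \in w0 :: sp]in_cons; case/or3P=> ->; rewrite ?orbT.
move=> /split1 /orP[y1|y1] /split2 /orP[y2|y2].
- move: us; rewrite sE catA -cat_cons cat_uniq => /and3P[_ /hasPn h _].
  by move: (h y); rewrite mem_cat y2 y1 => /(_ isT).
- have yW : y \in W by apply: sub2; rewrite inE y2 orbT.
  by move: (Ws _ yW); rewrite sE catA mem_cat y1.
- by move: (Ws _ (wsW _ y1)); rewrite sE -cat_cons !mem_cat y2 !orbT.
move: y2; rewrite inE => /orP[/eqP e|/spR]; last by rewrite y1 andbF.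
by rewrite -e y1 in w0ws.
Qed.

Lemma cyc_step n m : 4 <= n -> 3 <= m <= n -> n.*2 + m.-1./2 <= size V ->
  cyc c V n.-1 -> cyc c V n \/ cyc blue V m.
Proof.
move=> n4 /andP[m3 mn] szV cyn; have [|no] := classic (cyc c V n); first by left.
right; have nk : n = n.-1.+1 by rewrite prednK //; exact: leq_trans n4.
set k := n.-1 in nk cyn; rewrite nk in no.
have szW : 2 + m.-1./2 <= size V - k.*2.
  by move: szV n4; rewrite nk; clear; move: (size V) k => N k; lia.
have [m3e|m4] : m = 3 \/ 4 <= m by move: m3; clear; lia.
  have k3 : 3 <= k by move: n4; rewrite nk.
  case: cyn => x [s cy]; have szs : 6 <= size s by case: cy => _ _ -> _ _; move: k3; clear; lia.
  case: s szs cy => [|b1 [|a2 [|b2 [|a3 [|b3 s]]]]] // _ cy.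
  have [wk lx szs us sV] := cy.
  have un := @cycle_block_uniq k x [:: b1; a2; b2; a3] (b3 :: s) cy isT.
  have rg := cyc_rigid wk lx szs us sV no.
  have := size_outside us sV; rewrite szs; move: szW; rewrite m3e.
  case eW: (outside _) => [|u [|v [|y W]]] szW; rewrite /= => eszW;
    try by (rewrite -eszW in szW; discriminate szW).
  have sub : {subset [:: u; v; y] <= outside [:: b1, a2, b2, a3, b3 & s]}.
    by move=> z; rewrite eW !inE => /or3P[] ->; rewrite ?orbT.
  apply: cyc_lpath (@triangle_of_pair _ c hc x b1 a2 b2 a3 u v y _ _ _) => [z|||].
  - have sub1 z' : z' \in [:: u; v; y] -> z' \in V by move/sub/outside_sub.
    have xs : x \in [:: b1, a2, b2, a3, b3 & s].
      by rewrite -{1}lx; exact: (mem_last b1 [:: a2, b2, a3, b3 & s]).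
    rewrite in_cons -[[:: x, b1 & _]]/([:: x; b1; a2; b2; a3] ++ [:: v; y]) mem_cat in_cons.
    case/or3P=> [/eqP->|/orP[/eqP->|h]|h].
    + by apply: sub1; rewrite mem_head.
    + exact: sV.
    + by apply: sV; rewrite -[_ :: _]/([:: b1; a2; b2; a3] ++ (b3 :: s)) mem_cat h.
    + by apply: sub1; rewrite in_cons h orbT.
  - by move: wk; rewrite (@walk_cat _ c x [:: b1; a2; b2; a3] (b3 :: s)) // => /andP[].
  - apply: rigid_sub sub _.
    exact: (@rigid_block _ c x [::] [:: b1; a2; b2; a3] (b3 :: s)).
  - apply: (@uniq_cat_sub _ [:: x; b1; a2; b2; a3] (outside [:: b1, a2, b2, a3, b3 & s])) => //.
    have : uniq (outside [:: b1, a2, b2, a3, b3 & s]) by rewrite filter_uniq.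
    by rewrite eW; apply: subseq_uniq; rewrite /= !eqxx; exact: sub0seq.
(* The decomposition m = 2t + d + 3, where d = 1 for even m and d = 2 for odd m. *)
pose t := m./2 - 2; pose d := (odd m).+1.
have hd : (d == 1) || (d == 2) by rewrite /d; case: (odd m).
have em : m = t.*2 + d.+3 by rewrite /d /t; move: m4; clear; lia.
have szW2 : t + d.+2 <= size V - k.*2.
  by apply: leq_trans szW; rewrite /t /d; move: m4; clear; lia.
have szk : t.*2 + d.+2 <= k by move: mn; rewrite em nk; clear; lia.
(* Without a blue cycle of length m, [bad_case] excludes every bad pair, so [no_bad_case]
   applies. *)
rewrite em; apply: NNPP => nblue.
apply: (nblue); apply: (no_bad_case hd _ no cyn szk szW2) => x b1 a2 b2 a3 r u v s cy hN uW vW uv.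
apply: NNPP => nl; apply: nblue.
have szr : size r = k.*2 - 4 by case: cy => _ _ /= <- _ _; rewrite /=; clear; lia.
have [q [a [r' [er szq]]]] : exists q a r', r = q ++ a :: r' /\ size q = (d.*2).-1.
  have lt : (d.*2).-1 < size r.
    by rewrite szr; move: hd szk; clear; case/orP=> /eqP->; lia.
  exists (take (d.*2).-1 r), (nth x r (d.*2).-1), (drop (d.*2) r).
  split; last exact: size_takel (ltnW lt).
  have -> : d.*2 = (d.*2).-1.+1 by case/orP: hd => /eqP->.
  by rewrite -drop_nth // cat_take_drop.
rewrite /s er in cy hN uW vW.
have szr' : 4 * t <= size r'.
  have := szr; rewrite er size_cat szq /=; move: szk hd; clear.
  by move: (size r') => N h /orP[/eqP e|/eqP e]; rewrite e in h *; lia.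
have szW3 : t + d.+2 <= size (outside [:: b1, a2, b2, a3 & q ++ a :: r']).
  by case: cy => _ _ sz us sV; rewrite size_outside // sz.
exact: (bad_case hd szq cy no szr' szW3 uW vW uv hN nl).
Qed.
End KeyStep.

Lemma cyc_neg3K (T : eqType) (c : T -> T -> T -> bool) V k :
  cyc (neg3 (neg3 c)) V k -> cyc c V k.
Proof.
case=> x [s [h1 h2 h3 h4 h5]]; exists x, s; split=> //.
by rewrite -(eq_walk (c := neg3 (neg3 c))) // => i j l; rewrite /neg3 negbK.
Qed.

(** The shorter red cycle that [cyc_step] needs comes from the induction hypothesis, which allows
    only m up to the previous n. On the diagonal the smaller diagonal case is used: a red cycle is
    lengthened as usual, and a blue one by the step for [neg3 c]. *)
Theorem cyc_ramsey n m (T : eqType) (c : T -> T -> T -> bool) V :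
  sym3 c -> uniq V -> 3 <= m <= n -> n.*2 + m.-1./2 <= size V ->
  cyc c V n \/ cyc (neg3 c) V m.
Proof.
elim: n m c => [|n IH] m c hc uV /andP[m3 mn] szV; first by lia.
have [n3|n4] := leqP n 2.
  have [-> ->] : n = 2 /\ m = 3 by lia.
  by apply: seven_vertices => //; lia.
have small m' : 3 <= m' <= n -> n.+1.*2 + m'.-1./2 <= size V ->
    cyc c V n.+1 \/ cyc (neg3 c) V m'.
  move=> h sz; have [|cyn|] := IH m' c hc uV h; [by move: sz; clear; lia| |by right].
  by apply: (cyc_step hc uV) => //; lia.
have [/andP[_ mn']|e] : 3 <= m <= n \/ m = n.+1 by lia.
  by apply: small; rewrite ?m3.
rewrite {m m3 mn}e in szV *.
have h3 : 3 <= n <= n by rewrite n4 leqnn.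
have szn : n.+1.*2 + n.-1./2 <= size V by lia.
have [h|cyn] := small n h3 szn; first by left.
have n4' : 4 <= n.+1 by rewrite ltnS.
have h3' : 3 <= n.+1 <= n.+1 by rewrite leqnn ltnW.
by case: (cyc_step (sym3_neg hc) uV n4' h3' szV cyn) => [h|/cyc_neg3K h]; [right|left].
Qed.

(** * Red cycles without red paths *)

Section RedCycle.
Variables (T : eqType) (c : T -> T -> T -> bool) (V : seq T).
Hypotheses (hc : sym3 c) (uV : uniq V).
Implicit Types (x y z u v w : T) (p q s W ws zs : seq T).

Notation blue := (neg3 c).

Definition pth d k := exists x s,
  [/\ walk d x s, size s = k.*2, uniq (x :: s) & {subset x :: s <= V}].

Lemma pth_lpath d k u w S : u \notin w :: S -> {subset u :: w :: S <= V} ->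
  lpath d k u w S -> pth d k.
Proof.
move=> nu sub [q [h1 h2 h3 h4 h5]]; exists u, q; split=> //.
  by rewrite /= h4 andbT; apply: contra nu => /h5.
move=> y; rewrite inE => /orP[/eqP->|/h5 yS]; first by rewrite sub ?mem_head.
by apply: sub; rewrite inE yS orbT.
Qed.

Variable n : nat.
Hypothesis no_path : ~ pth c n.

(* Deleting the edge {x, b, a} from the cycle leaves a path from a to x with n - 1 edges,
   which no red edge may extend at either end. *)
Lemma deleted_edge_blue x b a r y z : is_cycle c V n x [:: b, a & r] ->
  y \in b :: outside V [:: b, a & r] -> z \in b :: outside V [:: b, a & r] -> y != z ->
  ~~ c z y a /\ ~~ c x y z.
Proof.
move=> [wk lx sz us sV] yin zin yz.
have new v : v \in b :: outside V [:: b, a & r] -> (v \notin a :: r) && (v \in V).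
  rewrite inE => /orP[/eqP->|]; first by case/andP: us => -> _; rewrite sV ?mem_head.
  by rewrite mem_filter [v \in b :: _]in_cons negb_or => /andP[/andP[_ ->]].
have [/andP[yr yV] /andP[zr zV]] := (new _ yin, new _ zin).
have [ua ur] : uniq (a :: r) /\ {subset a :: r <= V}.
  by split; [case/andP: us|move=> v vr; apply: sV; rewrite inE vr orbT].
have wr : walk c a r by case/andP: wk.
split; apply/negP => red; apply: no_path.
  exists z, [:: y, a & r]; split=> //.
  - by rewrite /= red.
  - by rewrite cons_uniq in_cons negb_or eq_sym yz zr cons_uniq yr.
  - by move=> v; rewrite in_cons => /orP[/eqP->//|]; rewrite in_cons => /orP[/eqP->|/ur].
exists a, (r ++ [:: y; z]); split.
- by rewrite walk_cat ?(walk_even wr) // wr -[last a r]/(last x [:: b, a & r]) lx /= red.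
- by rewrite size_cat -sz /= addn2.
- by rewrite -cat_cons cat_uniq ua [has _ _]/= (negbTE yr) (negbTE zr) /= inE yz.
- move=> v; rewrite -cat_cons mem_cat => /orP[/ur //|].
  by rewrite !in_cons orbF => /orP[] /eqP->.
Qed.

(** Deleting {x, b1, a2} shows that {u, b1, a2} is blue, and deleting {a2, b2, a3} shows that {a2,
    b2, v} is blue. No outside vertex is exceptional. *)
Lemma pair_inner x b1 a2 b2 a3 r u v :
  let W := outside V [:: b1, a2, b2, a3 & r] in
  is_cycle c V n x [:: b1, a2, b2, a3 & r] -> u \in W -> v \in W ->
  lpath blue 2 u v [:: b1; a2; b2].
Proof.
move=> W cy uW vW; have [_ _ _ us _] := cy.
have notin y : y \in W -> y \notin [:: b1, a2, b2, a3 & r] by rewrite mem_filter => /andP[].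
have cy2 : is_cycle c V n a2 [:: b2, a3 & r ++ [:: b1; a2]].
  exact: (@cycle_rot _ c V n x [:: b1; a2] [:: b2, a3 & r]).
have e2 : outside V [:: b2, a3 & r ++ [:: b1; a2]] = W.
  apply: eq_outside => y; rewrite -[[:: b2, a3 & _]]/([:: b2, a3 & r] ++ [:: b1; a2]).
  by rewrite mem_cat orbC -mem_cat.
have nb (y b : T) : y \in W -> b \in [:: b1, a2, b2, a3 & r] -> b != y.
  by move=> yW bin; apply: contraNneq (notin _ yW) => <-.
exists [:: b1; a2; b2; v]; split=> //.
- rewrite /= /neg3 andbT; apply/andP; split.
    by have [] := @deleted_edge_blue x b1 a2 [:: b2, a3 & r] b1 u cy _ _ _;
      rewrite ?mem_head ?in_cons ?uW ?orbT // nb // mem_head.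
  by have [] := @deleted_edge_blue a2 b2 a3 (r ++ [:: b1; a2]) b2 v cy2 _ _ _;
      rewrite ?mem_head ?in_cons ?e2 ?vW ?orbT // nb // !inE eqxx !orbT.
- apply: (@subseq_uniq _ _ ([:: b1; a2; b2] ++ [:: v])) => //.
  apply: (uniq_cat_sub (W := W)) => //; last by move=> y; rewrite inE => /eqP->.
  apply: subseq_uniq (uniq_outside uV us); rewrite -/W.
  apply: (@cat_subseq _ [:: b1; a2; b2] _ [:: b1; a2; b2] ((a3 :: r) ++ _)) => //.
  exact: suffix_subseq.
- by move=> y; rewrite !inE => /or4P[] ->; rewrite ?orbT.
Qed.

Lemma cycle_chain t x p G w ws : is_cycle c V n x (p ++ G) -> size p = 4 * t ->
  0 < size G -> size ws = t -> uniq (w :: ws) ->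
  {subset w :: ws <= outside V (p ++ G)} ->
  lpath blue t.*2 w (last w ws) (belast x p ++ ws).
Proof.
move=> cy szp szG szws uws sub; have un := cycle_block_uniq uV cy szG.
(* The exceptional vertices are chosen on the cycle, so every choice of linking vertices avoids
   them. *)
have [|zs [szz hZ hzs]] := @left_pairs_exist _ c V uV
  (fun z => z \notin outside V (p ++ G)) t n x [::] p G _ cy isT szp.
  move=> x1 b a b' a' r s cy1; exists x.
    by move: un; rewrite -cat_cons cat_uniq => /and3P[_ /hasPn h _]; apply/negP => /h;
      rewrite mem_head.
  move=> u v uW vW _ _ _; apply: lpath_sub (pair_inner cy1 uW vW) => y yin.
  by rewrite inE yin orbT.
rewrite -szz; apply: (left_chain un hzs) => //; move: sub hZ; rewrite -szz in szws.
elim: ws w {uws szz hzs} zs szws => [|w1 ws IH] w [|z zs] //= [e] sub /andP[zW zsW].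
have sub1 : {subset w1 :: ws <= outside V (p ++ G)}.
  by move=> y yw; apply: sub; rewrite inE yw orbT.
split; last exact: IH.
  by apply: contraNneq zW => <-; rewrite sub ?mem_head.
by apply: contraNneq zW => <-; rewrite sub1 ?mem_head.
Qed.

Lemma sub_cycle x s y : is_cycle c V n x s -> y \in s ++ outside V s -> y \in V.
Proof. by case=> _ _ _ _ sV; rewrite mem_cat => /orP[/sV|/outside_sub]. Qed.

Lemma cycle_start x s : is_cycle c V n x s -> 0 < size s -> x \in s.
Proof. by case: s => // y s [_ lx _ _ _] _; rewrite -{1}lx /= mem_last. Qed.

(* The chain of t pairs leaves the last joint of its block unused; w' and be are its two ends. *)
Lemma blue_chain t x p b a G : 0 < t -> size p = 4 * t ->
  let s := p ++ [:: b, a & G] in let be := last x p in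
  is_cycle c V n x s -> t < size (outside V s) ->
  exists w w' ws, [/\ w \in outside V s, {subset ws <= outside V s}, uniq (w :: ws),
    w' \in ws & lpath blue t.*2 w w' (belast x p ++ ws)] /\
    [/\ lpath blue 1 w' w [:: be] & lpath blue 1 w' be [:: b]].
Proof.
move=> t0 szp s be cy szW; have [_ _ szs us sV] := cy.
have [w [ws eW]] : exists w ws, take t.+1 (outside V s) = w :: ws.
  by case: (outside V s) szW => // w W _; exists w, (take t W).
have sub : {subset w :: ws <= outside V s} by move=> y; rewrite -eW => /mem_take.
have uws : uniq (w :: ws) by rewrite -eW take_uniq // filter_uniq.
have szws : size ws = t by have := congr1 size eW; rewrite size_takel // => -[].
have w'ws : last w ws \in ws.
  by case: (ws) szws t0 => [<-//|w1 ws1 _ _]; rewrite /= mem_last.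
have sW : {subset ws <= outside V s} by move=> y yw; apply: sub; rewrite inE yw orbT.
have wW := sub _ (mem_head w ws); have w'W := sW _ w'ws.
have w'w : last w ws != w by case/andP: uws => h _; apply: contraNneq h => <-.
have notin y z : y \in s -> z \in outside V s -> y != z.
  by move=> ys; rewrite mem_filter => /andP[h _]; apply: contraNneq h => <-.
have cyb : is_cycle c V n be [:: b, a & G ++ p].
  by apply: (@cycle_rot _ c V n x p [:: b, a & G]) => //; rewrite szp oddM.
have eb : outside V [:: b, a & G ++ p] = outside V s.
  apply: eq_outside => y; rewrite -[[:: b, a & G ++ p]]/([:: b, a & G] ++ p).
  by rewrite mem_cat orbC -mem_cat.
have bs : b \in s by rewrite mem_cat mem_head orbT.
have bes : be \in s.
  rewrite mem_cat /be; case: (p) szp t0 => [|y q] szp t0; last by rewrite /= mem_last.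
  by move: szp t0; rewrite /=; clear; lia.
have un : uniq (x :: (p ++ [:: b]) ++ outside V s).
  have := @cycle_block_uniq _ c V uV n x (p ++ [:: b]) (a :: G).
  by rewrite -catA; exact.
have [h1 h2] := hc.
exists w, (last w ws), ws; split; split=> //.
- exact: (cycle_chain cy).
- exists [:: be; w]; split=> //.
  + have [] := @deleted_edge_blue be b a (G ++ p) (last w ws) w cyb _ _ w'w;
      rewrite ?eb ?in_cons ?w'W ?wW ?orbT // => _.
    by rewrite /= /neg3 andbT h1.
  + by rewrite /= inE andbT notin.
  + by move=> y; rewrite !inE orbC.
- exists [:: b; be]; split=> //.
  + have [] := @deleted_edge_blue be b a (G ++ p) (last w ws) b cyb _ _ _;
      rewrite ?eb ?in_cons ?w'W ?wW ?eqxx ?orbT //; first by rewrite eq_sym notin.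
    by move=> _; rewrite /= /neg3 andbT h2 h1 h2 h1 h2.
  + rewrite /= inE andbT; apply: contraTneq un => e.
    rewrite -cat_cons -cat_cons -catA cat_uniq !negb_and; apply/orP; right; apply/orP; left.
    by rewrite negbK /= {1}e mem_last.
  + by move=> y; rewrite !inE orbC.
Qed.

(** With t = floor((m-1)/2) the chain takes t + 1 outside vertices, possibly all of them, so the
    missing one or two edges must come from the cycle. For m = 2t + 1, the edge {w', be, w} closes
    the cycle and {w', b, be} completes the path. For m = 2t + 2, the inner path w', b, a, b', w
    closes the cycle, while the path gets {w', b, be} at one end and {a, b', w} at the other. *)
Lemma blue_of_red_cycle m x s : 3 <= m <= n -> is_cycle c V n x s ->
  m.+1./2 <= size (outside V s) -> cyc blue V m /\ pth blue m.
Proof.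
move=> /andP[m3 mn] cy szW; have [_ _ szs us sV] := cy.
pose t := m.-1./2.
have t0 : 0 < t by rewrite /t; move: m3; clear; lia.
have tW : t < size (outside V s) by apply: leq_trans szW; rewrite /t; move: m3; clear; lia.
pose p := take (4 * t) s.
have [b [a [G eG]]] : exists b a G, drop (4 * t) s = [:: b, a & G].
  have: 2 <= size (drop (4 * t) s) by rewrite size_drop szs /t; move: m3 mn; clear; lia.
  by case: (drop _ _) => [|b [|a G]] // _; exists b, a, G.
have szp : size p = 4 * t by rewrite size_takel // szs /t; move: m3 mn; clear; lia.
have es : s = p ++ [:: b, a & G] by rewrite -eG cat_take_drop.
have := @blue_chain t x p b a G t0 szp; rewrite /= -es => /(_ cy tW).
move=> [w [w' [ws [[wW wsW uws w'ws ch] [l1 l2]]]]].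
set be := last x p in l1 l2; set W := outside V s in wW wsW tW.
have s0 : 0 < size s by rewrite szs; move: m3 mn; clear; lia.
have xs := cycle_start cy s0.
have notin y : y \in W -> y \notin s by rewrite mem_filter => /andP[].
have eB : x :: p = belast x p ++ [:: be] by rewrite lastI cats1.
have beV : be \in x :: p by exact: mem_last.
have un : uniq (x :: (p ++ [:: b]) ++ W).
  have := @cycle_block_uniq _ c V uV n x (p ++ [:: b]) (a :: G).
  by rewrite -catA -es; exact.
have sW : {subset [:: w] <= W} by move=> y; rewrite inE => /eqP->.
have uws1 : uniq (ws ++ [:: w]) by rewrite cats1 -rot1_cons rot_uniq.
have uA : uniq (belast x p ++ [:: be; b] ++ W).
  rewrite -[[:: be; b]]/([:: be] ++ [:: b]) -catA catA -eB.
  by move: un; rewrite -cat_cons -cat_cons -catA.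
have inV y : y \in belast x p ++ be :: [:: b, a & G] ++ W -> y \in V.
  rewrite -[be :: _]/([:: be] ++ _) catA -eB cat_cons in_cons => /orP[/eqP->|]; first exact: sV.
  by rewrite catA -es; exact: (sub_cycle cy).
have chW y : y \in belast x p ++ ws -> y \in V.
  rewrite mem_cat => yin; apply: inV; rewrite !(mem_cat, in_cons).
  by case/orP: yin => [->|/wsW ->]; rewrite ?orbT.
have wV : w \in V by exact: outside_sub wW.
have p1 : {subset w' :: belast x p ++ ws <= belast x p ++ ws}.
  by move=> y; rewrite in_cons => /orP[/eqP->|//]; rewrite mem_cat w'ws orbT.
have j2 : lpath blue (t.*2 + 1) w be (belast x p ++ [:: be; b] ++ ws ++ [::]).
  apply: (lpath_join ch l2 uA p1) => //; last by rewrite cats0; case/andP: uws.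
have j2in y : y \in belast x p ++ [:: be; b] ++ ws ++ [::] -> y \in V.
  rewrite cats0 => yin; apply: inV; move: yin; rewrite !(mem_cat, in_cons, in_nil).
  by case/or3P=> [->|/or3P[->|->|//]|/wsW ->]; rewrite ?orbT.
have beV' : be \in V by apply: inV; rewrite mem_cat mem_head orbT.
have wnot : w \notin be :: belast x p ++ [:: be; b] ++ ws ++ [::].
  have ws' : w \notin ws by case/andP: uws.
  have wn : w \notin belast x p ++ [:: be; b].
    move: uA; rewrite catA cat_uniq => /and3P[_ /hasPn /(_ w wW) h _]; exact: h.
  rewrite cats0 catA in_cons mem_cat (negbTE ws') (negbTE wn) /= orbF.
  by apply: contraNneq wn => ->; rewrite mem_cat mem_head orbT.
have [em|em] : m = t.*2 + 1 \/ m = t.*2 + 2 by rewrite /t; move: m3; clear; lia.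
  rewrite em; split; last first.
    apply: (pth_lpath wnot _ j2) => y.
    by rewrite !in_cons => /or3P[/eqP->//|/eqP->//|/j2in].
  have uA1 : uniq (belast x p ++ [:: be] ++ W).
    apply: subseq_uniq uA; rewrite cat_subseq // -[[:: be; b]]/([:: be] ++ [:: b]) -catA.
    by rewrite cat_subseq // suffix_subseq.
  apply: cyc_lpath (lpath_join (A' := ws) (B' := [:: w]) ch l1 uA1 p1 _ wsW sW uws1) => y.
    rewrite in_cons => /orP[/eqP->//|]; rewrite !mem_cat !mem_seq1.
    by case/or4P=> [yB|/eqP->//|yw|/eqP->//]; apply: chW; rewrite mem_cat ?yB ?yw ?orbT.
  by rewrite !(mem_cat, in_cons, in_nil) !orbF orbC.
have [b' [a' [G' eG']]] : exists b' a' G', G = [:: b', a' & G'].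
  have: 2 <= size G.
    by move: szs; rewrite es size_cat szp /=; move: mn; rewrite em; clear; lia.
  by case: (G) => [|b' [|a' G']] // _; exists b', a', G'.
have un3 : uniq (x :: (p ++ [:: b; a; b']) ++ W).
  have := @cycle_block_uniq _ c V uV n x (p ++ [:: b; a; b']) (a' :: G').
  by rewrite -catA -[_ ++ a' :: G']/([:: b, a, b', a' & G']) -eG' -es; exact.
have unA : uniq (belast x p ++ [:: be; b; a; b'] ++ W).
  rewrite -[[:: be, b & _]]/([:: be] ++ [:: b; a; b']) -catA catA -eB.
  by move: un3; rewrite -cat_cons -cat_cons -catA.
have evp : ~~ odd (size p) by rewrite szp oddM.
have cyb : is_cycle c V n be [:: b, a, b', a' & G' ++ p].
  apply: (@cycle_rot _ c V n x p [:: b, a, b', a' & G']) => //.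
  by rewrite -eG' -es.
have eb : outside V [:: b, a, b', a' & G' ++ p] = W.
  apply: eq_outside => y; rewrite es eG' -[[:: b, a & _]]/([:: b, a, b', a' & G'] ++ p).
  by rewrite mem_cat orbC -mem_cat.
have bV y : y \in [:: b; a; b'] -> y \in V.
  move=> yin; apply: inV; rewrite eG' -[be :: _]/([:: be] ++ [:: b; a; b'] ++ (a' :: G') ++ W).
  by rewrite !mem_cat yin !orbT.
rewrite em; split.
  have l3 : lpath blue 2 w' w [:: b; a; b'].
    by apply: (pair_inner cyb); rewrite eb // wsW.
  have uA3 : uniq (belast x p ++ [:: b; a; b'] ++ W).
    apply: subseq_uniq unA; rewrite cat_subseq // cat_subseq //; exact: subseq_cons.
  apply: cyc_lpath (lpath_join (A' := ws) (B' := [:: w]) ch l3 uA3 p1 _ wsW sW uws1) => y.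
    rewrite in_cons => /orP[/eqP->//|]; rewrite !mem_cat [y \in [:: w]]mem_seq1.
    case/or4P=> [yB|/bV//|yw|/eqP->//]; apply: chW; by rewrite mem_cat ?yB ?yw ?orbT.
  by rewrite in_cons mem_cat mem_seq1 orbC.
have cya : is_cycle c V n a [:: b', a' & (G' ++ p) ++ [:: b; a]].
  exact: (@cycle_rot _ c V n be [:: b; a] [:: b', a' & G' ++ p]).
have ea : outside V [:: b', a' & (G' ++ p) ++ [:: b; a]] = W.
  rewrite -eb; apply: eq_outside => y.
  rewrite -[[:: b', a' & (G' ++ p) ++ _]]/([:: b', a' & G' ++ p] ++ _).
  by rewrite mem_cat orbC -mem_cat.
have b'w : b' != w.
  apply: contraNneq (notin w wW) => <-; by rewrite es eG' mem_cat !in_cons eqxx !orbT.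
(* Blue because deleting {a, b', a'} leaves a red path that starts or ends at [a]. *)
have l0 : lpath blue 1 a w [:: b'].
  exists [:: b'; w]; split=> //.
  + have [] := @deleted_edge_blue a b' a' ((G' ++ p) ++ [:: b; a]) b' w cya _ _ b'w;
      rewrite ?ea ?in_cons ?wW ?eqxx ?orbT // => _.
    by rewrite /= /neg3 => ->.
  + by rewrite /= inE b'w.
  + by move=> y; rewrite !inE orbC.
have j0 := lpath_join (A := [:: b']) (A' := [:: w])
  (B := belast x p ++ [:: be; b]) (B' := ws) (W := W) l0 j2.
have un5 : uniq (a :: [:: b'] ++ (belast x p ++ [:: be; b]) ++ W).
  rewrite -(perm_uniq (s1 := belast x p ++ [:: be; b; a; b'] ++ W)) //.
  apply/permP => q; rewrite /= !count_cat /=.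
  move: (count q _) (count q _) (nat_of_bool _) (nat_of_bool _) (nat_of_bool _) (nat_of_bool _).
  by clear; lia.
have aV : a \in V by apply: bV; rewrite !inE eqxx orbT.
have sub1 : {subset w :: [:: b'] <= [:: b'] ++ [:: w]} by move=> y; rewrite !inE orbC.
have sub2 :
    {subset be :: belast x p ++ [:: be; b] ++ ws ++ [::] <= (belast x p ++ [:: be; b]) ++ ws}.
  by move=> y; rewrite cats0 catA in_cons => /orP[/eqP->|//]; rewrite !mem_cat mem_head !orbT.
have un6 : uniq ([:: b'] ++ (belast x p ++ [:: be; b]) ++ W) by case/andP: un5.
have aW y : y \in [:: w] ++ ws -> y \in W by rewrite mem_cat => /orP[/sW|/wsW].
rewrite (_ : t.*2 + 2 = 1 + (t.*2 + 1)); last by rewrite addnCA.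
apply: (pth_lpath _ _ (j0 un6 sub1 sub2 sW wsW uws)) => [|y].
  have: a \notin [:: b'] ++ (belast x p ++ [:: be; b]) ++ W by case/andP: un5.
  apply: contra; rewrite in_cons => /orP[/eqP->|]; first by rewrite !mem_cat mem_head !orbT.
  rewrite mem_cat => /orP[h|]; first by rewrite mem_cat h.
  by rewrite mem_cat => /orP[h|/aW h]; rewrite mem_cat [a \in _ ++ W]mem_cat h ?orbT.
rewrite in_cons => /orP[/eqP->//|]; rewrite in_cons => /orP[/eqP->//|].
rewrite mem_cat => /orP[yb|]; first by apply: bV; move: yb; rewrite !inE => ->; rewrite !orbT.
rewrite mem_cat => /orP[yB|/aW yW]; last exact: outside_sub yW.
by apply: j2in; rewrite catA mem_cat yB.
Qed.
End RedCycle.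

Lemma pth_cyc (T : eqType) (c : T -> T -> T -> bool) V k : cyc c V k.+1 -> pth V c k.
Proof.
case=> x [[|b [|a r]] [wk lx sz us sV]] //; exists a, r; split.
- by case/andP: wk.
- by case: sz.
- by case/andP: us.
- by move=> y yr; apply: sV; rewrite inE yr orbT.
Qed.

Lemma pth_neg3K (T : eqType) (c : T -> T -> T -> bool) V k :
  pth V (neg3 (neg3 c)) k -> pth V c k.
Proof.
case=> x [s [h1 h2 h3 h4]]; exists x, s; split=> //.
by rewrite -(eq_walk (c := neg3 (neg3 c))) // => i j l; rewrite /neg3 negbK.
Qed.

Lemma blue_of_cyc (T : eqType) (c : T -> T -> T -> bool) (V : seq T) n m :
  sym3 c -> uniq V -> 3 <= m <= n -> n.*2 + m.+1./2 <= size V -> cyc c V n ->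
  pth V c n \/ cyc (neg3 c) V m /\ pth V (neg3 c) m.
Proof.
move=> hc uV mn szV [x [s cy]]; have [|no] := classic (pth V c n); first by left.
right; apply: (blue_of_red_cycle hc uV no mn cy).
have [_ _ sz us sV] := cy.
by rewrite size_outside // sz leq_subRL //; apply: leq_trans szV; exact: leq_addr.
Qed.

Theorem pth_cyc_ramsey n m (T : eqType) (c : T -> T -> T -> bool) V :
  sym3 c -> uniq V -> 3 <= m <= n -> n.*2 + m.+1./2 <= size V ->
  pth V c n \/ cyc (neg3 c) V m.
Proof.
move=> hc uV mn szV; have [|cy|] := cyc_ramsey hc uV mn; [by lia| |by right].
by case: (blue_of_cyc hc uV mn szV cy) => [|[]]; [left|right].
Qed.

(** For m < n a blue cycle of length m + 1 would do, since it contains the path, and floor(m/2) does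
    not exceed floor((m+1)/2). For m = n that length is out of reach; a cycle of length n of either
    colour is used instead, and the two colours are symmetric. *)
Theorem pth_ramsey n m (T : eqType) (c : T -> T -> T -> bool) V :
  sym3 c -> uniq V -> 3 <= m <= n -> n.*2 + m.+1./2 <= size V ->
  pth V c n \/ pth V (neg3 c) m.
Proof.
move=> hc uV mn szV; have [lt|e] : m < n \/ m = n by lia.
  have mn1 : 3 <= m.+1 <= n by lia.
  have [|cy|/pth_cyc] := cyc_ramsey hc uV mn1; [by lia| |by right].
  by case: (blue_of_cyc hc uV mn szV cy) => [|[]]; [left|right].
have [|cy|cy] := cyc_ramsey hc uV mn; first by lia.
  by case: (blue_of_cyc hc uV mn szV cy) => [|[]]; [left|right].
rewrite e in cy mn szV *.
have [h|[_ /pth_neg3K h]] := blue_of_cyc (sym3_neg hc) uV mn szV cy; by [right|left].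
Qed.

(** * Copies and lower bounds *)

Definition colour N (d : {set 'I_N} -> bool) x y z := d [set x; y; z].

Lemma sym3_colour N (d : {set 'I_N} -> bool) : sym3 (colour d).
Proof. by split=> x y z; rewrite /colour; [rewrite (setUC [set x])|rewrite setUAC]. Qed.

Lemma card_set3 (T : finType) (x y z : T) : uniq [:: x; y; z] -> #|[set x; y; z]| = 3.
Proof.
rewrite /= !inE negb_or andbT => /andP[/andP[xy xz] yz].
by rewrite setUC cardsU1 cards2 xy !inE negb_or !(eq_sym z) xz yz.
Qed.

Lemma contains_path N (d : {set 'I_N} -> bool) n V : pth V (colour d) n ->
  contains_copy [set e in complete_hypergraph 3 N | d e] (loose_path 3 n).
Proof.
case=> x [s [wk sz un _]].
have szs : size s = n * 3.-1 by rewrite sz -muln2.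
pose f (v : 'I_(n * 3.-1).+1) := nth x (x :: s) v.
have inj : injective f.
  move=> u v /eqP; rewrite /f nth_uniq // ?[size _]/= ?szs ?ltn_ord //.
  by move/eqP/val_inj.
exists f; split=> // _ /imsetP[i _ ->].
have lti : i.*2.+2 < (n * 3.-1).+1 by have := ltn_ord i; rewrite -muln2 /=; lia.
pose v0 := Ordinal (ltnW (ltnW lti)); pose v1 := Ordinal (ltnW lti); pose v2 := Ordinal lti.
have -> : loose_path_edge 3 i = [set v0; v1; v2].
  by apply/setP => v; rewrite !inE -!val_eqE /=; clear; lia.
have lti' : i.*2.+1 < size s by rewrite szs.
have h : d [set f v0; f v1; f v2] := walk_nth x wk lti'.
rewrite !imsetU !imset_set1 !inE h.
by rewrite andbT card_set3 // /= !inE !(inj_eq inj) -!val_eqE /=; clear; lia.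
Qed.

Lemma contains_cycle N (d : {set 'I_N} -> bool) n V : 2 <= n -> cyc (colour d) V n ->
  contains_copy [set e in complete_hypergraph 3 N | d e] (loose_cycle 3 n).
Proof.
move=> n2 [x [s [wk lx sz us _]]].
have szs : size s = n * 3.-1 by rewrite sz -muln2.
(* The closed walk ends at [x]; [belast x s] lists the same vertices as [s] with [x] first, as
   vertex 0. *)
pose f (v : 'I_(n * 3.-1)) := nth x (belast x s) v.
have ub : uniq (belast x s).
  rewrite -(perm_uniq (s1 := s)) // -(perm_cons x).
  by rewrite [x :: s]lastI lx perm_rcons.
have inj : injective f.
  move=> u v /eqP; rewrite /f nth_uniq // ?size_belast ?szs ?ltn_ord //.
  by move/eqP/val_inj.
have fE (v : 'I_(n * 3.-1)) : f v = nth x (x :: s) v.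
  by rewrite lastI nth_rcons size_belast szs ltn_ord.
exists f; split=> // _ /imsetP[i _ ->].
have lti : i.*2.+1 < n * 3.-1 by have := ltn_ord i; rewrite -muln2 /=; lia.
have lt2 : i.*2.+2 %% (n * 3.-1) < n * 3.-1 by rewrite ltn_mod; lia.
pose v0 := Ordinal (ltnW lti); pose v1 := Ordinal lti; pose v2 := Ordinal lt2.
have f2 : f v2 = nth x (x :: s) i.*2.+2.
  rewrite fE (_ : v2 = i.*2.+2 %% (n * 3.-1) :> nat) //.
  have [e|lt] : i.*2.+2 = n * 3.-1 \/ i.*2.+2 < n * 3.-1 by lia.
    by rewrite e modnn -szs -last_nth lx.
  by rewrite modn_small.
have -> : loose_cycle_edge 3 i = [set v0; v1; v2].
  apply/setP => v; rewrite !inE -!val_eqE /=; apply/existsP/idP.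
    case=> -[[|[|[|j]]] //= lj] /eqP ->.
    - by rewrite addn0 muln2 modn_small ?eqxx //; exact: ltnW lti.
    - by rewrite addn1 muln2 modn_small ?eqxx ?orbT.
    - by rewrite addn2 muln2 eqxx ?orbT.
  case/orP=> [/orP[]|] /eqP->.
  - by exists ord0; rewrite /= addn0 muln2 modn_small //; exact: ltnW lti.
  - by exists (Ordinal (isT : 1 < 3)); rewrite /= addn1 muln2 modn_small.
  - by exists ord_max; rewrite /= addn2 (muln2 i).
have lti' : i.*2.+1 < size s by rewrite szs.
have h : d [set f v0; f v1; f v2] by rewrite f2 !fE; exact: walk_nth wk lti'.
rewrite !imsetU !imset_set1 !inE h.
rewrite andbT card_set3 // /= !inE !(inj_eq inj) -!val_eqE /=.
have [e|lt] : i.*2.+2 = n * 3.-1 \/ i.*2.+2 < n * 3.-1 by lia.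
  by rewrite e modnn; move: n2 e; clear; lia.
by rewrite modn_small //; clear; lia.
Qed.

(* A vertex on two of the edges E i is the start of exactly one of them; since every blue edge
   contains one of the N - a vertices outside the red set, there are at most 2 (N - a) edges E i. *)
Lemma no_arrow (k N a m : nat) (V W : finType) (G : hypergraph V) (H : hypergraph W)
    (E : 'I_m -> {set W}) (start : 'I_m -> W) :
  (forall v, exists2 e, e \in G & v \in e) -> a < #|V| ->
  (forall i, E i \in H) ->
  (forall i j v, v \in E i -> v \in E j -> (v == start i) = (v == start j) -> i = j) ->
  (N - a).*2 < m -> ~ ramsey_arrow k G H N.
Proof.
move=> cov ltV EH sep ltm arrow.
(* Every vertex of [G] lies on an edge, so a red copy would place all of [G] among [a] vertices. *)
have [[f [inj red]]|[f [inj blue]]] := arrow (fun e => [forall v in e, v < a]).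
  have lt v : f v < a.
    have [e eG ve] := cov v; have := red _ eG; rewrite !inE => /andP[_ /forall_inP h].
    by apply: h; rewrite imset_f.
  have finj : injective (fun v => Ordinal (lt v)).
    by move=> u v /(congr1 val) /= /val_inj /inj.
  have := leq_card _ finj.
  by rewrite card_ord leqNgt ltV.
have big i : exists v, (v \in E i) && (a <= f v).
  have := blue _ (EH i); rewrite !inE => /andP[_ /forall_inPn[_ /imsetP[v vE ->] h]].
  by exists v; rewrite vE leqNgt.
pose g i := xchoose (big i).
have gP i : (g i \in E i) && (a <= f (g i)) := xchooseP (big i).
have lt i : f (g i) - a < N - a.
  by case/andP: (gP i) => _ h; rewrite ltn_sub2r //; apply: leq_ltn_trans h _; exact: ltn_ord.
pose h i := (Ordinal (lt i), g i == start i).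
have hinj : injective h.
  move=> i j [e1 e2]; have [/andP[gi li] /andP[gj lj]] := (gP i, gP j).
  have e : g i = g j.
    by apply/inj/val_inj => /=; rewrite -(subnK li) e1 subnK.
  by apply: (sep i j (g i)) => //; [rewrite e|rewrite e2 e].
have := leq_card h hinj; rewrite card_prod !card_ord card_bool muln2.
by rewrite leqNgt ltm.
Qed.

Lemma path_cover n v : 0 < n -> exists2 e, e \in loose_path 3 n & v \in e.
Proof.
(* The last vertex 2n has half n and belongs to edge n - 1; this is the reason for [minn]. *)
move=> n0; have lti : minn v./2 n.-1 < n by lia.
exists (loose_path_edge 3 (Ordinal lti)); first exact: imset_f.
by rewrite inE /=; move: (ltn_ord v) => /=; move: (nat_of_ord v) => k; clear -n0; lia.
Qed.

Lemma cycle_cover n v : exists2 e, e \in loose_cycle 3 n & v \in e.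
Proof.
have lti : v./2 < n by have := ltn_ord v; rewrite /=; lia.
have ltj : odd v < 3 by case: odd.
exists (loose_cycle_edge 3 (Ordinal lti)); first exact: imset_f.
rewrite inE; apply/existsP; exists (Ordinal ltj) => /=.
by rewrite (muln2 v./2) addnC odd_double_half modn_small // ltn_ord.
Qed.

(** A vertex on two edges is the last vertex of one and the joint 2i at which the other starts. *)
Lemma no_arrow_to_path k N a m (V : finType) (G : hypergraph V) :
  (forall v, exists2 e, e \in G & v \in e) -> a < #|V| -> (N - a).*2 < m ->
  ~ ramsey_arrow k G (loose_path 3 m) N.
Proof.
move=> cov ltV ltm.
apply: (@no_arrow k N a m _ _ G _ (fun i => loose_path_edge 3 i)
  (fun i : 'I_m => inord (i * 2)) cov ltV) => // [i|i j v].
  exact: imset_f.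
rewrite !inE -!val_eqE /= !inordK; first by move=> h1 h2 h3; apply: val_inj => /=; lia.
- by have := ltn_ord j; lia.
- by have := ltn_ord i; lia.
Qed.

Lemma no_arrow_to_cycle k N a m (V : finType) (G : hypergraph V) : 2 <= m ->
  (forall v, exists2 e, e \in G & v \in e) -> a < #|V| -> (N - a).*2 < m ->
  ~ ramsey_arrow k G (loose_cycle 3 m) N.
Proof.
move=> m2 cov ltV ltm.
have ltf (i : 'I_m) : i * 2 < m * 3.-1 by have := ltn_ord i; rewrite /=; lia.
apply: (@no_arrow k N a m _ _ G _ (fun i => loose_cycle_edge 3 i)
  (fun i : 'I_m => Ordinal (ltf i)) cov ltV) => // [i|i j v].
  exact: imset_f.
have inE' (i' : 'I_m) : v \in loose_cycle_edge 3 i' ->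
    [\/ v = i' * 2 :> nat, v = (i' * 2).+1 :> nat |
      v = (if i'.+1 == m then 0 else i'.+1 * 2) :> nat].
  rewrite inE => /existsP[[[|[|[|?]]] //= lj]] /eqP->.
  - by constructor 1; rewrite addn0 modn_small.
  - by constructor 2; rewrite addn1 modn_small //; have := ltn_ord i'; lia.
  - constructor 3; have [e|ne] := eqVneq i'.+1 m.
      by rewrite (_ : i' * 2 + 2 = m * 3.-1) ?modnn //=; lia.
    by rewrite addnC -mulSn modn_small //= ltn_mul2r /=; have := ltn_ord i'; lia.
move=> /inE' h1 /inE' h2; rewrite -!val_eqE /= => h3; apply: val_inj => /=.
move: (ltn_ord i) (ltn_ord j) h1 h2 h3; clear -m2.
by case: eqP => e1; case: eqP => e2 li lj [] -> []; lia.
Qed.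

Theorem theorem2p9 (n m : nat) (hm : 3 <= m) (hnm : m <= n) :
  exists rPP rPC rCC : nat,
    [/\ is_ramsey_number 3 (loose_path 3 n) (loose_path 3 m) rPP,
        is_ramsey_number 3 (loose_path 3 n) (loose_cycle 3 m) rPC,
        is_ramsey_number 3 (loose_cycle 3 n) (loose_cycle 3 m) rCC
      & [/\ rPP = rPC, rPC = rCC + 1 & rCC + 1 = 2 * n + (m + 1) %/ 2]].
Proof.
have mn : 3 <= m <= n by rewrite hm.
have n2 : 2 <= n by lia.
have m2 : 2 <= m by lia.
pose N := n.*2 + m.+1./2.
have uV M : uniq (enum 'I_M) := enum_uniq _.
have red M (c : {set 'I_M} -> bool) := sym3_colour c.
exists N, N, N.-1; split; last by split=> //; rewrite /N; lia.
- split=> [c|M arrow].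
    have [|h|h] := pth_ramsey (red _ c) (uV _) mn; first by rewrite size_enum_ord.
      by left; exact: contains_path h.
    by right; exact: (@contains_path _ (fun e => ~~ c e) _ _ h).
  (* The path of length n has 2n + 1 vertices. At most floor((m-1)/2) vertices lie outside the red
     set, and twice that number is less than m. *)
  rewrite leqNgt; apply/negP => lt; apply: (@no_arrow_to_path 3 M n.*2 m _ _ _ _ _ arrow).
  + by move=> v; apply: path_cover; lia.
  + by rewrite card_ord /=; lia.
  + by rewrite /N in lt; lia.
- split=> [c|M arrow].
    have [|h|h] := pth_cyc_ramsey (red _ c) (uV _) mn; first by rewrite size_enum_ord.
      by left; exact: contains_path h.
    by right; exact: (@contains_cycle _ (fun e => ~~ c e) _ _ m2 h).
  rewrite leqNgt; apply/negP => lt.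
  apply: (@no_arrow_to_cycle 3 M n.*2 m _ _ m2 _ _ _ arrow).
  + by move=> v; apply: path_cover; lia.
  + by rewrite card_ord /=; lia.
  + by rewrite /N in lt; lia.
- split=> [c|M arrow].
    have [|h|h] := cyc_ramsey (red _ c) (uV _) mn; first by rewrite size_enum_ord /N; lia.
      by left; exact: contains_cycle n2 h.
    by right; exact: (@contains_cycle _ (fun e => ~~ c e) _ _ m2 h).
  rewrite leqNgt; apply/negP => lt.
  apply: (@no_arrow_to_cycle 3 M n.*2.-1 m _ _ m2 _ _ _ arrow).
  + exact: cycle_cover.
  + by rewrite card_ord /=; lia.
  + by rewrite /N in lt; lia.
Qed.
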